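(* Let $A$ be a nonzero Banach algebra with a bounded approximate identity and an $F\ell^1(\eta)$-base $\mathscr L$ for some infinite cardinal $\eta$ and some integer $m\in\mathbb N$ ($m=1$ for types 1 and 2). Let $X=\bigcup_{k=1}^mX_k\subseteq LUC(A)^*$ with $X_k=\{\Psi_{pk}:p\in\mathscr C(\eta)\}$, and let $\widetilde X\subseteq A^{**}$ consist of one fixed norm-preserving extension to $A^*$ of each element of $X$. Let $\mathscr S$ be any subsemigroup of $LUC(A)^*$ with $X\subseteq\mathscr S$, or any subsemigroup of $A^{**}$ with $\widetilde X\subseteq\mathscr S$. Then: (1) if $\mathscr L$ is of type 1 or 2, there are at least $2^{2^\eta}$ many right cancellable elements in $\mathscr S$; (2) if $\mathscr L$ is of type 3, there are at least $2^{2^\eta}$ many right cancellable sets in $\mathscr S$.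
   Context: Right cancellable. A set $\Gamma$ in an algebra is right cancellable if for every nonzero element $a$ of the algebra there is $x\in\Gamma$ with $ax\ne0$; an element $x$ is right cancellable if $\{x\}$ is. The same definition is applied in a subsemigroup $\mathscr S$ (with $a$ ranging over the nonzero elements of $\mathscr S$, and $\Gamma\subseteq\mathscr S$). Products. $\langle S\cdot a,b\rangle=\langle S,ab\rangle$ for $S\in A^*$, $a,b\in A$. $LUC(A)$ is the closed linear span of $\{S\cdot a\}$ in $A^*$. For $\Psi$ in $A^{**}$ or $LUC(A)^*$, $\langle\Psi\cdot S,a\rangle=\langle\Psi,S\cdot a\rangle$. $A^{**}$ and $LUC(A)^*$ carry the first Arens product $\langle\Phi\Psi,S\rangle=\langle\Phi,\Psi\cdot S\rangle$ ($S\in A^*$, resp. $S\in LUC(A)$). Right multipliers. $M_r(A)$ is the algebra of bounded operators $R$ on $A$ with $R(ab)=aR(b)$, with product $R_1R_2=R_2\circ R_1$; $A$ sits in $M_r(A)$ by right multiplications, and $aR=R(a)\in A$ for $a\in A$. With a bai $(e_i)$, $R\in M_r(A)$ is viewed in $LUC(A)^*$ as the weak$^*$-limit of $(R(e_i))$, i.e. $\langle R,S\cdot a\rangle=\langle S,aR\rangle$. $\langle E\rangle$ denotes linear span; cardinals are identified with initial ordinals. $\ell^1(\eta)$-base: a bounded set, indexed by a set of cardinality $\eta$, for which there is $K>0$ with $\sum_{n=1}^p|z_n|\le K\|\sum_{n=1}^pz_nx_n\|$ for all $p$, scalars $z_n$ and distinct elements $x_1,\dots,x_p$ of the set. $\ell^1(\eta)$-selective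 base with constant $K_1>0$: a bounded set $\mathscr L=\bigcup_{\alpha<\eta}\mathscr L_\alpha$, $\mathscr L_\alpha\neq\emptyset$, such that the spans $\langle\mathscr L_\alpha\rangle$ have zero pairwise intersections and $\sum_{n=1}^p\|x_n\|\le K_1\|\sum_{n=1}^px_n\|$ whenever $x_n\in\langle\mathscr L_{\alpha_n}\rangle$ with $\alpha_1,\dots,\alpha_p$ distinct. Zooming set in $A$: a set $\bigcup_{\alpha<\eta}A_\alpha a_\alpha$ where (i) $\{A_\alpha\}_{\alpha<\eta}$ is an increasing family of subsets of $A$ with $A_\eta=\bigcup_{\alpha<\eta}A_\alpha$ bounded (by $1$, say) and of closed linear span $A$; (ii) $\{a_\alpha:\alpha<\eta\}$ is bounded in $M_r(A)$; (iii) the spans $\langle A_\alpha a_\alpha\rangle$ have zero pairwise intersections. $F\ell^1(\eta)$-base of type 1: a zooming set that is an $\ell^1(\eta)$-base, the elements $aa_\alpha$ being indexed by the pairs $(\alpha,a)$, $a\in A_\alpha$. Type 2: a zooming set that is an $\ell^1(\eta)$-selective base (with $\mathscr L_\alpha=A_\alpha a_\alpha$) such that for some $K_2>0$, $\|a\|\le K_2\|aa_\alpha\|$ for all $a\in\langle A_\alpha\rangle$, $\alpha<\eta$. Type 3: a set $\bigcup_{\alpha<\eta}A_\alpha\{a_\alpha^k:k=1,\dots,m\}$ which is an $\ell^1(\eta)$-selective base with $\mathscr L_\alpha=\bigcup_{k=1}^mA_\alpha a_\alpha^k$, where $\{A_\alpha\}$ is as in (i), $\{\mathbf a_\alpha=(a_\alpha^k)_{k=1}^m\}$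 is bounded in $M_r(A)^m$, for each $k$ the spans $\langle A_\alpha a_\alpha^k\rangle$ have zero pairwise intersections, and for some $K_2>0$, $\|a\|\le K_2\|(aa_\alpha^k)_{k=1}^m\|$ for all $a\in\langle A_\alpha\rangle$, $\alpha<\eta$ (any $p$-norm on $A^m$). For types 1 and 2 put $m=1$, $a_\alpha^1=a_\alpha$. Cluster points. $\mathscr C(\eta)$ is the set of cofinal ultrafilters on $\eta$ (all members cofinal in $\eta$). For $p\in\mathscr C(\eta)$, $\Psi_{pk}\in LUC(A)^*$ is the weak$^*$-limit along $p$ of $\alpha\mapsto a_\alpha^k\in M_r(A)\subseteq LUC(A)^*$. *)

(* Defs.v *)
From HB Require Import structures.
From mathcomp Require Import all_boot all_order all_algebra.
From mathcomp Require Import all_classical all_reals all_analysis.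
From mathcomp Require Import complex.

Set Implicit Arguments.
Unset Strict Implicit.
Unset Printing Implicit Defensive.

Import Order.TTheory GRing.Theory Num.Theory.
Import numFieldNormedType.Exports.

Local Open Scope classical_set_scope.
Local Open Scope ring_scope.

(* Banach algebras are taken over R or over R[i], uniformly in [s]. The norm of
   a normed module takes its values in the scalar field, hence the coercions
   [of_real] and [to_real] (the real part). *)
Variant scalars := RealScalars | ComplexScalars.

Definition scalar_field (R : realType) (s : scalars) : numFieldType :=
  match s with
  | RealScalars => R : numFieldType
  | ComplexScalars => R[i] : numFieldType
  end.

Section Scalars.
Variables (R : realType) (s : scalars).
Local Notation K := (scalar_field R s).

Definition of_real : R -> K :=
  match s return R -> scalar_field R s with
  | RealScalars => fun r => r
  | ComplexScalars => fun r => r%:C%C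
  end.

Definition to_real : K -> R :=
  match s return scalar_field R s -> R with
  | RealScalars => fun z => z
  | ComplexScalars => fun z => complex.Re z
  end.

Lemma to_realK (x : K) : 0 <= x -> of_real (to_real x) = x.
Proof.
rewrite /of_real /to_real; case: s x => //= -[a b].
by rewrite lecE /= => /andP[/eqP-> _].
Qed.

Lemma of_realK : cancel of_real to_real.
Proof. by rewrite /of_real /to_real; case: s. Qed.

Lemma ler_of_real : {mono of_real : x y / x <= y}.
Proof. by rewrite /of_real; case: s => //= x y; rewrite lecR. Qed.

Lemma of_real_ge0 (r : R) : (0 <= of_real r) = (0 <= r).
Proof.
rewrite -ler_of_real; congr (_ <= _).
by rewrite /of_real; case: s.
Qed.

End Scalars.

Section BoundedOperators.
Variables (R : realType) (s : scalars).
Local Notation K := (scalar_field R s).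
Variables (V W : normedModType K).

Definition is_bounded_linear (f : V -> W) : Prop :=
  linear f /\ exists M : K, forall x, `|f x| <= M * `|x|.

Definition blin_pred : {pred (V -> W)} := fun f => `[< is_bounded_linear f >].

Record blin := Blin { blin_fun :> V -> W; blinP : blin_fun \in blin_pred }.

HB.instance Definition _ := [isSub for blin_fun].
HB.instance Definition _ := [Choice of blin by <:].

Lemma blin_submod_closed : submod_closed blin_pred.
Proof.
split=> [|a f g].
  apply/asboolP; split=> [k x y|]; first by rewrite /= scaler0 addr0.
  by exists 0 => x; rewrite normr0 mul0r.
move=> /asboolP[lf [M fM]] /asboolP[lg [N gN]]; apply/asboolP; split.
  have E z : (a *: f + g) z = a *: f z + g z by [].
  move=> k x y; rewrite !E lf lg.
  by rewrite !scalerDr !scalerA (mulrC k) addrACA.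
exists (`|a| * M + N) => x; rewrite mulrDl -mulrA.
apply: (le_trans (ler_normD _ _)); apply: lerD => //=.
by rewrite normrZ ler_wpM2l.
Qed.

HB.instance Definition _ :=
  GRing.isSubmodClosed.Build K (V -> W) blin_pred blin_submod_closed.
HB.instance Definition _ := [SubChoice_isSubLmodule of blin by <:].

Lemma blin_linear (f : blin) : linear f.
Proof. by case: f => f /= /asboolP[]. Qed.

HB.instance Definition _ (f : blin) :=
  GRing.isLinear.Build K V W _ (blin_fun f) (@blin_linear f).

Definition mk_blin (f : V -> W) (bf : is_bounded_linear f) : blin :=
  Blin (introT (asboolP (is_bounded_linear f)) bf).

Definition opnorm (f : blin) : K :=
  of_real s (sup [set to_real `|f x| | x in [set x : V | `|x| <= 1]]).

Lemma opnorm_has_sup (f : blin) :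
  has_sup [set to_real `|f x| | x in [set x : V | `|x| <= 1]].
Proof.
split; first by exists (to_real `|f 0|); exists 0 => //=; rewrite normr0.
have /asboolP[_ [M fM]] := blinP f.
exists (to_real `|M|) => _ [x /= x1 <-].
rewrite -(@ler_of_real _ s) !to_realK //.
apply: (le_trans (fM x)); apply: (@le_trans _ _ `|M * `|x| |).
  by apply: real_ler_norm; rewrite (ger0_real (le_trans (normr_ge0 _) (fM x))).
by rewrite normrM normr_id ler_piMr.
Qed.

Lemma opnorm_le (f : blin) x : `|f x| <= opnorm f * `|x|.
Proof.
have [->|x0] := eqVneq x 0; first by rewrite linear0 !normr0 mulr0.
rewrite -ler_pdivrMr ?normr_gt0 //.
have -> : `|f x| / `|x| = `|f (`|x|^-1 *: x)|.
  by rewrite linearZ /= normrZ normfV normr_id mulrC.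
rewrite -[leLHS]to_realK // ler_of_real.
apply: (ub_le_sup (proj2 (opnorm_has_sup f))).
exists (`|x|^-1 *: x) => //=.
by rewrite normrZ normfV normr_id mulVf // normr_eq0.
Qed.

Lemma opnorm_lub (f : blin) (M : K) :
  (forall x, `|x| <= 1 -> `|f x| <= M) -> opnorm f <= M.
Proof.
move=> fM; have M0 : 0 <= M.
  by apply: le_trans (fM 0 _) => //; rewrite normr0.
rewrite /opnorm -(to_realK M0) ler_of_real.
apply: ge_sup; first exact: (proj1 (opnorm_has_sup f)).
by move=> _ [x /= x1 <-]; rewrite -(@ler_of_real _ s) !to_realK // fM.
Qed.

Lemma opnorm_ge0 (f : blin) : 0 <= opnorm f.
Proof.
rewrite of_real_ge0; apply: (@le_trans _ _ (to_real `|f 0|)).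
  by rewrite -(of_real_ge0 s) to_realK.
apply: (ub_le_sup (proj2 (opnorm_has_sup f))).
by exists 0 => //=; rewrite normr0.
Qed.

Lemma opnormD (f g : blin) : opnorm (f + g) <= opnorm f + opnorm g.
Proof.
apply: opnorm_lub => x x1; apply: (le_trans (ler_normD _ _)).
by apply: lerD; apply: (le_trans (opnorm_le _ _)); rewrite ler_piMr ?opnorm_ge0.
Qed.

Lemma opnormZ (k : K) (f : blin) : opnorm (k *: f) = `|k| * opnorm f.
Proof.
have le_opZ (l : K) (g : blin) : opnorm (l *: g) <= `|l| * opnorm g.
  apply: opnorm_lub => x x1.
  rewrite [X in `|X|](_ : _ = l *: g x) // normrZ ler_wpM2l //.
  by apply: (le_trans (opnorm_le _ _)); rewrite ler_piMr ?opnorm_ge0.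
have [->|k0] := eqVneq k 0.
  by apply/eqP; rewrite eq_le le_opZ normr0 mul0r opnorm_ge0.
apply/eqP; rewrite eq_le le_opZ /=.
rewrite -ler_pdivlMl ?normr_gt0 // -normfV.
by apply: le_trans (le_opZ _ _); rewrite scalerA mulVf // scale1r.
Qed.

Lemma opnorm0_eq0 (f : blin) : opnorm f = 0 -> f = 0.
Proof.
move=> f0; apply/val_inj/funext => x /=.
by apply/normr0_eq0/le_anti; rewrite normr_ge0 andbT -(mul0r `|x|) -f0 opnorm_le.
Qed.

HB.instance Definition _ :=
  Lmodule_isNormed.Build K blin opnormD opnormZ opnorm0_eq0.

Lemma blin_norm_le (f : blin) x : `|f x| <= `|f| * `|x|.
Proof. exact: opnorm_le. Qed.

Lemma blin_norm_lub (f : blin) (M : K) :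
  (forall x, `|x| <= 1 -> `|f x| <= M) -> `|f| <= M.
Proof. exact: opnorm_lub. Qed.

End BoundedOperators.

Notation dual V := (blin V (scalar_field _ _)^o).

Section Span.
Variables (R : realType) (s : scalars).
Local Notation K := (scalar_field R s).
Variable V : normedModType K.

Definition span (E : set V) : set V :=
  [set x | exists n (c : 'I_n -> K) (v : 'I_n -> V),
     (forall i, E (v i)) /\ x = \sum_(i < n) c i *: v i].

Lemma span_linear (E : set V) (a : K) (x y : V) :
  span E x -> span E y -> span E (a *: x + y).
Proof.
move=> [n [c [v [Ev ->]]]] [m [d [w [Ew ->]]]].
exists (n + m)%N, (fun i => match fintype.split i with inl j => a * c j | inr j => d j end),
  (fun i => match fintype.split i with inl j => v j | inr j => w j end); split.
  by move=> i; case: (fintype.split i).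
rewrite big_split_ord /= scaler_sumr; congr (_ + _); apply: eq_bigr => i _.
  by rewrite (unsplitK (inl i)) scalerA.
by rewrite (unsplitK (inr i)).
Qed.

Lemma closure_normP (E : set V) (x : V) :
  closure E x <-> forall e : K, 0 < e -> exists2 y, E y & `|x - y| < e.
Proof.
split=> [cEx e e0|H B /nbhs_ballP[e /= e0 eB]].
  by have [y [Ey]] := cEx _ (nbhsx_ballx x e e0); rewrite -ball_normE; exists y.
have [y Ey xy] := H e e0; exists y; split=> //.
by apply: eB; rewrite -ball_normE.
Qed.

Lemma closure_span_submod (E : set V) :
  submod_closed (fun x => `[< closure (span E) x >]).
Proof.
split.
  apply/asboolP/subset_closure; exists 0%N, (fun=> 0), (fun=> 0).
  by split=> [[]|] //; rewrite big_ord0.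
move=> a x y /asboolP/closure_normP xE /asboolP/closure_normP yE.
apply/asboolP/closure_normP => e e0.
have a1 : 0 < `|a| + 1 by rewrite ltr_wpDl.
have [x' Ex' xx'] := xE (e / 2 / (`|a| + 1)) (divr_gt0 (divr_gt0 e0 (ltr0Sn _ 1)) a1).
have [y' Ey' yy'] := yE (e / 2) (divr_gt0 e0 (ltr0Sn _ 1)).
exists (a *: x' + y'); first exact: span_linear.
rewrite opprD addrACA -scalerBr (le_lt_trans (ler_normD _ _)) //.
rewrite (splitr e) ler_ltD // normrZ.
apply: (@le_trans _ _ ((`|a| + 1) * `|x - x'|)); first by rewrite ler_wpM2r ?lerDl.
by rewrite mulrC -ler_pdivlMr // ltW.
Qed.

End Span.

HB.mixin Record isBanachAlgebra (K : numFieldType) A & CompleteNormedModule K A := {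
  amul : A -> A -> A ;
  amulA : associative amul ;
  amul_linearl : forall b, linear (amul^~ b) ;
  amul_linearr : forall a, linear (amul a) ;
  amul_norm : forall a b, `|amul a b| <= `|a| * `|b|
}.

#[short(type="banachAlgType")]
HB.structure Definition BanachAlgebra (K : numFieldType) :=
  {A of CompleteNormedModule K A & isBanachAlgebra K A}.

Section BanachAlgebras.
Variables (R : realType) (s : scalars).
Local Notation K := (scalar_field R s).
Variable A : banachAlgType K.

Lemma dual_act_bounded (S : dual A) (a : A) :
  is_bounded_linear (fun b => S (amul a b) : K^o).
Proof.
split=> [k x y|]; first by rewrite amul_linearr linearP.
exists (`|S| * `|a|) => x; apply: (le_trans (blin_norm_le _ _)).
by rewrite -mulrA ler_wpM2l ?amul_norm.
Qed.

Definition dual_act (S : dual A) (a : A) : dual A :=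
  mk_blin (dual_act_bounded S a).

Definition luc_pred : {pred dual A} := fun S =>
  `[< closure (span [set T | exists S a, T = dual_act S a]) S >].

Record LUC := Luc { luc_fun :> dual A; lucP : luc_fun \in luc_pred }.

HB.instance Definition _ := [isSub for luc_fun].
HB.instance Definition _ := [Choice of LUC by <:].
HB.instance Definition _ :=
  GRing.isSubmodClosed.Build K (dual A) luc_pred (closure_span_submod _).
HB.instance Definition _ := [SubChoice_isSubLmodule of LUC by <:].

Definition luc_norm (S : LUC) : K := `|luc_fun S|.

Lemma luc_normD (S T : LUC) : luc_norm (S + T) <= luc_norm S + luc_norm T.
Proof. exact: ler_normD. Qed.

Lemma luc_normZ (k : K) (S : LUC) : luc_norm (k *: S) = `|k| * luc_norm S.
Proof. exact: normrZ. Qed.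

Lemma luc_norm0_eq0 (S : LUC) : luc_norm S = 0 -> S = 0.
Proof. by move=> S0; apply/val_inj/normr0_eq0. Qed.

HB.instance Definition _ :=
  Lmodule_isNormed.Build K LUC luc_normD luc_normZ luc_norm0_eq0.

Lemma luc_act_subproof (S : dual A) (a : A) : dual_act S a \in luc_pred.
Proof.
apply/asboolP/subset_closure; exists 1%N, (fun=> 1), (fun=> dual_act S a).
by split=> [_|]; [exists S, a | rewrite big_ord1 scale1r].
Qed.

Definition luc_act (S : dual A) (a : A) : LUC := Luc (luc_act_subproof S a).

Lemma dual_act_linear (S : dual A) : linear (dual_act S).
Proof.
move=> k a b; apply/val_inj/funext => x /=.
by rewrite amul_linearl linearP.
Qed.

Lemma dual_actP (k : K) (S T : dual A) (a : A) :
  dual_act (k *: S + T) a = k *: dual_act S a + dual_act T a.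
Proof. exact/val_inj/funext. Qed.

Lemma luc_act_linear (S : dual A) : linear (luc_act S).
Proof. by move=> k a b; apply/val_inj/dual_act_linear. Qed.

Lemma luc_actP (k : K) (S T : dual A) (a : A) :
  luc_act (k *: S + T) a = k *: luc_act S a + luc_act T a.
Proof. exact/val_inj/dual_actP. Qed.

Lemma dual_act_norm (S : dual A) (a : A) : `|dual_act S a| <= `|S| * `|a|.
Proof.
apply: blin_norm_lub => x x1 /=; apply: (le_trans (blin_norm_le _ _)).
rewrite ler_wpM2l //; apply: (le_trans (amul_norm _ _)).
by rewrite ler_piMr.
Qed.

Lemma luc_act_norm (S : dual A) (a : A) : `|luc_act S a| <= `|S| * `|a|.
Proof. exact: dual_act_norm. Qed.

Lemma bidual_act_bounded (Psi : dual (dual A)) (S : dual A) :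
  is_bounded_linear (fun a => Psi (dual_act S a) : K^o).
Proof.
split=> [k a b|]; first by rewrite dual_act_linear linearP.
exists (`|Psi| * `|S|) => a; apply: (le_trans (blin_norm_le _ _)).
by rewrite -mulrA ler_wpM2l // dual_act_norm.
Qed.

Definition bidual_act (Psi : dual (dual A)) (S : dual A) : dual A :=
  mk_blin (bidual_act_bounded Psi S).

Lemma arens_bounded (Phi Psi : dual (dual A)) :
  is_bounded_linear (fun S => Phi (bidual_act Psi S) : K^o).
Proof.
split=> [k S T|].
  rewrite -linearP; congr (Phi _); apply/val_inj/funext => a /=.
  by rewrite dual_actP linearP.
exists (`|Phi| * `|Psi|) => S; apply: (le_trans (blin_norm_le _ _)).
rewrite -mulrA ler_wpM2l //; apply: blin_norm_lub => a a1 /=.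
apply: (le_trans (blin_norm_le _ _)); rewrite ler_wpM2l //.
by apply: (le_trans (dual_act_norm _ _)); rewrite ler_piMr.
Qed.

Definition arens (Phi Psi : dual (dual A)) : dual (dual A) :=
  mk_blin (arens_bounded Phi Psi).

(* For Psi in the dual of LUC(A), Psi . S is defined for every S in the dual of
   A; it lies in LUC(A) when S does, so that the first Arens product makes
   sense on the dual of LUC(A). *)
Lemma lucdual_act_bounded (Psi : dual LUC) (S : dual A) :
  is_bounded_linear (fun a => Psi (luc_act S a) : K^o).
Proof.
split=> [k a b|]; first by rewrite luc_act_linear linearP.
exists (`|Psi| * `|S|) => a; apply: (le_trans (blin_norm_le _ _)).
by rewrite -mulrA ler_wpM2l ?luc_act_norm.
Qed.

Definition lucdual_act (Psi : dual LUC) (S : dual A) : dual A :=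
  mk_blin (lucdual_act_bounded Psi S).

Lemma lucdual_act_linear (Psi : dual LUC) : linear (lucdual_act Psi).
Proof.
move=> k S T; apply/val_inj/funext => a /=.
by rewrite luc_actP linearP.
Qed.

Lemma lucdual_act_norm (Psi : dual LUC) (S : dual A) :
  `|lucdual_act Psi S| <= `|Psi| * `|S|.
Proof.
apply: blin_norm_lub => a a1 /=; apply: (le_trans (blin_norm_le _ _)).
rewrite ler_wpM2l //; apply: (le_trans (luc_act_norm _ _)).
by rewrite ler_piMr.
Qed.

Lemma lucdual_act_dual_act (Psi : dual LUC) (S : dual A) (a : A) :
  lucdual_act Psi (dual_act S a) = dual_act (lucdual_act Psi S) a.
Proof.
apply/val_inj/funext => b /=; congr (Psi _).
by apply/val_inj/val_inj/funext => c /=; rewrite amulA.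
Qed.

Lemma lucdual_act_sum (Psi : dual LUC) n (c : 'I_n -> K) (v : 'I_n -> dual A) :
  lucdual_act Psi (\sum_(i < n) c i *: v i) =
  \sum_(i < n) c i *: lucdual_act Psi (v i).
Proof.
elim: n c v => [|n IHn] c v; last first.
  by rewrite !big_ord_recl lucdual_act_linear IHn.
rewrite !big_ord0; apply/val_inj/funext => a /=.
have -> : luc_act 0 a = 0 by apply/val_inj/val_inj/funext.
by rewrite linear0.
Qed.

Lemma lucdual_act_subproof (Psi : dual LUC) (S : LUC) :
  lucdual_act Psi S \in luc_pred.
Proof.
have /asboolP/closure_normP cS := lucP S.
apply/asboolP/closure_normP => e e0.
have P1 : 0 < `|Psi| + 1 by rewrite ltr_wpDl.
have [T [n [c [v [Ev TE]]]] ST] := cS (e / (`|Psi| + 1)) (divr_gt0 e0 P1).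
exists (lucdual_act Psi T).
  exists n, c, (lucdual_act Psi \o v); split=> [i|]; last first.
    by rewrite TE lucdual_act_sum.
  have [U [a va]] := Ev i; exists (lucdual_act Psi U), a.
  by rewrite /= va lucdual_act_dual_act.
have -> : lucdual_act Psi S - lucdual_act Psi T = lucdual_act Psi (luc_fun S - T).
  by rewrite addrC -scaleN1r -lucdual_act_linear scaleN1r addrC.
apply: (le_lt_trans (lucdual_act_norm _ _)).
apply: (@le_lt_trans _ _ ((`|Psi| + 1) * `|luc_fun S - T|)).
  by rewrite ler_wpM2r ?lerDl.
by rewrite mulrC -ltr_pdivlMr.
Qed.

Definition luc_lucdual_act (Psi : dual LUC) (S : LUC) : LUC :=
  Luc (lucdual_act_subproof Psi S).

Lemma luc_arens_bounded (Phi Psi : dual LUC) :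
  is_bounded_linear (fun S => Phi (luc_lucdual_act Psi S) : K^o).
Proof.
split=> [k S T|].
  rewrite -linearP; congr (Phi _); apply/val_inj.
  exact: lucdual_act_linear.
exists (`|Phi| * `|Psi|) => S; apply: (le_trans (blin_norm_le _ _)).
by rewrite -mulrA; apply: ler_wpM2l => //; apply: lucdual_act_norm.
Qed.

Definition luc_arens (Phi Psi : dual LUC) : dual LUC :=
  mk_blin (luc_arens_bounded Phi Psi).

End BanachAlgebras.

Section Hypotheses.
Variables (R : realType) (s : scalars).
Local Notation K := (scalar_field R s).
Variable A : banachAlgType K.

(* Nets are families along a proper filter; the identity is two-sided. *)
Definition has_bounded_approximate_identity : Prop :=
  exists (J : Type) (F : set_system J) (e : J -> A),
    [/\ ProperFilter F, bounded_fun e,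
        forall a : A, amul a (e i) @[i --> F] --> a
      & forall a : A, amul (e i) a @[i --> F] --> a].

Definition right_multiplier : set (blin A A) :=
  [set T | forall a b, T (amul a b) = amul a (T b)].

(* An infinite initial ordinal, as the well-ordered set of its elements *)
Definition infinite_cardinal d (eta : orderType d) : Prop :=
  [/\ infinite_set [set: eta],
      wochoice.well_order (<=%O : rel eta)
    & forall al : eta, ~ ([set: eta] #<= [set be : eta | (be < al)%O])%card].

Variables (d : Order.disp_t) (eta : orderType d).

(* The set is given as the image of D under x. Its elements are indexed by D:
   the inequality makes x injective on D. *)
Definition l1_base (J : Type) (D : set J) (x : J -> A) : Prop :=
  [/\ (D #= [set: eta])%card,
      bounded_set (x @` D)
    & exists2 K0 : K, 0 < K0 &
        forall n (j : 'I_n -> J) (z : 'I_n -> K), injective j ->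
          (forall i, D (j i)) ->
          \sum_(i < n) `|z i| <= K0 * `|\sum_(i < n) z i *: x (j i)| ].

Definition zero_intersections (L : eta -> set A) : Prop :=
  forall al be, al != be -> span (L al) `&` span (L be) = [set 0].

Definition l1_selective_base (L : eta -> set A) : Prop :=
  [/\ forall al, L al !=set0,
      bounded_set (\bigcup_al L al),
      zero_intersections L
    & exists2 K1 : K, 0 < K1 &
        forall n (al : 'I_n -> eta) (x : 'I_n -> A), injective al ->
          (forall i, span (L (al i)) (x i)) ->
          \sum_(i < n) `|x i| <= K1 * `|\sum_(i < n) x i| ].

Definition exhausting (A_ : eta -> set A) : Prop :=
  [/\ forall al be, (al <= be)%O -> A_ al `<=` A_ be,
      bounded_set (\bigcup_al A_ al)
    & closure (span (\bigcup_al A_ al)) = setT].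

Definition bounded_multipliers (a_ : eta -> blin A A) : Prop :=
  (forall al, right_multiplier (a_ al)) /\ bounded_fun a_.

Definition zooming (A_ : eta -> set A) (a_ : eta -> blin A A) : Prop :=
  [/\ exhausting A_, bounded_multipliers a_
    & zero_intersections (fun al => a_ al @` A_ al)].

(* The families a_ are indexed by k < m for all three types. *)
Definition Fl1_base1 m (A_ : eta -> set A) (a_ : 'I_m -> eta -> blin A A) : Prop :=
  m = 1%N /\ forall k,
    zooming A_ (a_ k) /\
    l1_base [set q : eta * A | A_ q.1 q.2] (fun q => a_ k q.1 q.2).

Definition Fl1_base2 m (A_ : eta -> set A) (a_ : 'I_m -> eta -> blin A A) : Prop :=
  m = 1%N /\ forall k,
    [/\ zooming A_ (a_ k),
        l1_selective_base (fun al => a_ k al @` A_ al)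
      & exists2 K2 : K, 0 < K2 &
          forall al a, span (A_ al) a -> `|a| <= K2 * `|a_ k al a| ].

(* On the m-fold powers of A and of M_r(A) all p-norms are equivalent. *)
Definition Fl1_base3 m (A_ : eta -> set A) (a_ : 'I_m -> eta -> blin A A) : Prop :=
  [/\ exhausting A_,
      forall k, bounded_multipliers (a_ k),
      forall k, zero_intersections (fun al => a_ k al @` A_ al),
      l1_selective_base (fun al => \bigcup_k (a_ k al @` A_ al))
    & exists2 K2 : K, 0 < K2 &
        forall al a, span (A_ al) a -> `|a| <= K2 * \sum_(k < m) `|a_ k al a| ].

Definition cofinal_ultrafilter (p : set_system eta) : Prop :=
  UltraFilter p /\ forall B, p B -> forall al, exists2 be, B be & (al <= be)%O.

(* Psi is the image in the dual of LUC(A) of the right multiplier T; this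
   determines Psi, as the S . a span a dense subspace of LUC(A). *)
Definition multiplier_functional (T : blin A A) (Psi : dual (LUC A)) : Prop :=
  forall (S : dual A) (a : A), Psi (luc_act S a) = S (T a).

Definition weak_star_limit (p : set_system eta) (a_ : eta -> blin A A)
    (Psi : dual (LUC A)) : Prop :=
  exists rho : eta -> dual (LUC A),
    (forall al, multiplier_functional (a_ al) (rho al)) /\
    forall f : LUC A, rho al f @[al --> p] --> Psi f.

Definition cluster_points m (a_ : 'I_m -> eta -> blin A A) : set (dual (LUC A)) :=
  \bigcup_(k : 'I_m) [set Psi |
    exists2 p, cofinal_ultrafilter p & weak_star_limit p (a_ k) Psi].

Definition norm_preserving_extension (Psi : dual (LUC A)) (Phi : dual (dual A)) :=
  (forall f : LUC A, Phi (luc_fun f) = Psi f) /\ `|Phi| = `|Psi|.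

End Hypotheses.

Section Cancellation.
Variables (T : zmodType) (mul : T -> T -> T).

Definition subsemigroup (S : set T) : Prop :=
  forall x y, S x -> S y -> S (mul x y).

Definition right_cancellable_in (S G : set T) : Prop :=
  G `<=` S /\ forall a, S a -> a != 0 -> exists2 x, G x & mul a x != 0.

End Cancellation.

(* Main.v *)
(* Let [Psi_p,k] be the weak* limit of [a_ k al] along a cofinal ultrafilter p.
   By Hahn-Banach, the base allows one to prescribe, for every T in the dual of A
   and every subset B of eta, functionals S_k with [sum_k S_k (a_ k al a) = T a]
   for al in B and [S_k (a_ j al a) = 0] for al outside B (a in A_ al).
   If B is in p this gives [sum_k Psi_p,k . S_k = T]: every T is reached, so a
   functional annihilated by right multiplication by all the Psi_p,k vanishes on
   everything. If the complement of B is in q, then [Psi_q,j . S_k = 0] for all j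
   and k, so {Psi_p,k : k < m} determines p. There are 2^2^eta cofinal
   ultrafilters (Pospisil): every choice of signs on an independent family of
   2^eta subsets of eta is compatible with the filter of final segments. *)
From HB Require Import structures.
From mathcomp Require Import all_boot all_order all_algebra complex ring lra.
From mathcomp Require Import all_classical all_reals all_analysis.
Require Import Defs.

Set Implicit Arguments.
Unset Strict Implicit.
Unset Printing Implicit Defensive.

Import Order.TTheory GRing.Theory Num.Theory.
Import numFieldNormedType.Exports.

Local Open Scope classical_set_scope.
Local Open Scope ring_scope.

(** * Cofinal ultrafilters *)

Lemma card_le_injective T U (B : set U) (f : T -> U) :
  injective f -> (forall x, B (f x)) -> ([set: T] #<= B)%card.
Proof.
move=> finj fB; have : (range f #= [set: T])%card by apply: inj_card_eq => x y _ _ /finj.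
move=> /card_eqPle[_ Tle]; apply: card_le_trans Tle (subset_card_le _).
by move=> _ [x _ <-]; exact: fB.
Qed.

(** Zorn's lemma on the graphs of partial injections from [C] to [D]: if a maximal graph missed both
    some [c] in [C] and some [d] in [D], the pair [(c, d)] could be added to it. *)
Lemma injection_comparable T (C D : set T) :
  (exists g : T -> T, set_fun C D g /\ set_inj C g) \/
  (exists g : T -> T, set_fun D C g /\ set_inj D g).
Proof.
pose P (G : set (T * T)) := [/\ forall u, G u -> C u.1 /\ D u.2,
  forall u v, G u -> G v -> u.1 = v.1 -> u = v &
  forall u v, G u -> G v -> u.2 = v.2 -> u = v].
have [F FP Ft|G [[GCD G1 G2] Gmax]] := @Zorn_bigcup _ P.
  have F2 u v : (\bigcup_(X in F) X) u -> (\bigcup_(X in F) X) v ->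
      exists2 X, F X & X u /\ X v.
    move=> [X FX Xu] [Y FY Yv]; have [XY|YX] := Ft _ _ FX FY.
      by exists Y => //; split=> //; exact: XY.
    by exists X => //; split=> //; exact: YX.
  split=> [u [X FX Xu]|u v Fu Fv|u v Fu Fv].
  - by have [H _ _] := FP _ FX; exact: H.
  - by have [X FX [Xu Xv]] := F2 _ _ Fu Fv; have [_ H _] := FP _ FX; exact: H.
  - by have [X FX [Xu Xv]] := F2 _ _ Fu Fv; have [_ _ H] := FP _ FX; exact: H.
have [domG|/existsNP[c /not_implyP[Cc nc]]] :=
    pselect (forall c, C c -> exists d, G (c, d)).
  left; have /choice[g gP] : forall c, exists d, C c -> G (c, d).
    move=> c; have [/domG[d Gd]|nCc] := pselect (C c); first by exists d.
    by exists c.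
  exists g; split=> [c /gP/GCD[]//|c c' /set_mem/gP Gc /set_mem/gP Gc' gcc'].
  by have [] := G2 _ _ Gc Gc' gcc'.
have [ranG|/existsNP[d /not_implyP[Dd nd]]] :=
    pselect (forall d, D d -> exists c, G (c, d)).
  right; have /choice[g gP] : forall d, exists c, D d -> G (c, d).
    move=> d'; have [/ranG[c' Gd]|nDd] := pselect (D d'); first by exists c'.
    by exists d'.
  exists g; split=> [c' /gP/GCD[]//|d' d'' /set_mem/gP Gc /set_mem/gP Gc' gcc'].
  by have [] := G1 _ _ Gc Gc' gcc'.
exfalso; apply: (Gmax (G `|` [set (c, d)])); last split.
- split=> [u|GU]; first by left.
  by apply: nc; exists d; apply: GU; right.
- by move=> u [/GCD//|->].
- move=> u v [Gu|->] [Gv|->] //= uv; first exact: G1.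
    by case: nc; exists u.2; rewrite -uv -surjective_pairing.
  by case: nc; exists v.2; rewrite uv -surjective_pairing.
- move=> u v [Gu|->] [Gv|->] //= uv; first exact: G2.
    by case: nd; exists u.1; rewrite -uv -surjective_pairing.
  by case: nd; exists v.1; rewrite uv -surjective_pairing.
Qed.

Lemma infinite_nat_injection T : infinite_set [set: T] ->
  exists i : nat -> T, injective i.
Proof.
move=> /infiniteP/card_leP[u].
exists (fun n => set_val (u (SigSub (mem_set (I : [set: nat] n))))) => x y /val_inj.
move=> /(@inj _ _ _ u _ _ (in_setT _) (in_setT _)).
by case.
Qed.

(** Zorn's lemma on pairs of a set [D] containing a fixed countable set [N] and an injective pairing
    of [D], ordered by extension. The set [N] provides the starting pair and the two distinct tags
    needed at the end. *)
Lemma infinite_square_injection T : infinite_set [set: T] ->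
  exists f : T * T -> T, injective f.
Proof.
move=> /infinite_nat_injection [i iinj]; pose N := range i.
pose code (D : set T) (f : T -> T -> T) :=
  (forall x y, D x -> D y -> D (f x y)) /\
  (forall x y x' y', D x -> D y -> D x' -> D y' ->
     f x y = f x' y' -> x = x' /\ y = y').
pose Q := {u : set T * (T -> T -> T) | N `<=` u.1 /\ code u.1 u.2}.
pose le (u v : Q) := `[< (sval u).1 `<=` (sval v).1 /\
  forall x y, (sval u).1 x -> (sval u).1 y -> (sval u).2 x y = (sval v).2 x y >].
have le0 u : le u u by apply/asboolP; split.
have letr : forall v u w, le v u -> le u w -> le v w.
  move=> v u w /asboolP[uv1 uv2] /asboolP[vw1 vw2]; apply/asboolP; split.
    by move=> x /uv1/vw1.
  by move=> x y ux uy; rewrite uv2 // vw2 //; exact: uv1.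
have [u0 _] : exists u : Q, True.
  have /choice[r rP] : forall x, exists n, N x -> x = i n.
    move=> x; have [[n _ <-]|nx] := pselect (N x); first by exists n.
    by exists 0%N.
  pose f x y := i (pickle (r x, r y)).
  suff Nf : N `<=` N /\ code N f by exists (exist _ (N, f) Nf).
  split=> //; split=> [x y _ _|x y x' y' Nx Ny Nx' Ny'].
    by exists (pickle (r x, r y)).
  move=> /iinj/(pcan_inj pickleK)[rx ry].
  by rewrite (rP x Nx) (rP y Ny) (rP x' Nx') (rP y' Ny') rx ry.
have [|[[D f] Dcode] Dmax] := ZL_preorder u0 le0 letr.
  move=> F Ft; have [[v0 Fv0]|F0] := pselect (exists v, F v); last first.
    by exists u0 => s Fs; case: F0; exists s.
  pose D x := exists2 u, F u & (sval u).1 x.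
  have DD x y : D x -> D y -> exists2 u, F u & (sval u).1 x /\ (sval u).1 y.
    move=> [u Fu ux] [v Fv vy]; have [/asboolP[uv _]|/asboolP[vu _]] := Ft _ _ Fu Fv.
      by exists v => //; split=> //; exact: uv.
    by exists u => //; split=> //; exact: vu.
  (* On the union of the chain, [x] and [y] are paired by a member [r (x, y)] of the chain
     containing both; [fE] shows that every such member gives the same value. *)
  have /choice[r rP] : forall p : T * T, exists u, D p.1 -> D p.2 ->
      [/\ F u, (sval u).1 p.1 & (sval u).1 p.2].
    move=> p; have [[p1 p2]|np] := pselect (D p.1 /\ D p.2); last first.
      by exists u0 => ? ?; case: np.
    by have [u Fu [? ?]] := DD _ _ p1 p2; exists u.
  pose f x y := (sval (r (x, y))).2 x y.
  have fE u x y : F u -> (sval u).1 x -> (sval u).1 y -> f x y = (sval u).2 x y.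
    move=> Fu ux uy; have [] := rP (x, y); [by exists u|by exists u|].
    rewrite /f; move: (r (x, y)) => v /= Fv vx vy.
    have [/asboolP[_ uv]|/asboolP[_ vu]] := Ft _ _ Fu Fv; first by rewrite uv.
    by rewrite vu.
  suff Dcode : N `<=` D /\ code D f.
    exists (exist _ (D, f) Dcode) => u Fu; apply/asboolP; split=> /= [x ux|x y ux uy].
      by exists u.
    by rewrite (fE u).
  split; first by move=> x Nx; exists v0 => //; have [H _] := svalP v0; exact: H.
  split=> [x y Dx Dy|x y x' y' Dx Dy Dx' Dy'].
    have [u Fu [ux uy]] := DD _ _ Dx Dy; exists u => //; rewrite (fE u) //.
    by have [_ [H _]] := svalP u; exact: H.
  have [u Fu [ux uy]] := DD _ _ Dx Dy; have [v Fv [vx' vy']] := DD _ _ Dx' Dy'.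
  have [/asboolP[uv _]|/asboolP[vu _]] := Ft _ _ Fu Fv.
    rewrite !(fE v) //; try exact: uv.
    by have [_ [_ H]] := svalP v; apply: H => //; exact: uv.
  rewrite !(fE u) //; try exact: vu.
  by have [_ [_ H]] := svalP u; apply: H => //; exact: vu.
have [/= ND [Df finj]] := Dcode.
pose t (b : bool) := i b.
have Dt b : D (t b) by apply: ND; exists (b : nat).
have tinj b b' : t b = t b' -> b = b' by move=> /iinj; case: b; case: b'.
(* If the complement of D embeds in D, then so does T. Otherwise D has a disjoint
   copy [g @` D], and the code extends to their union, against maximality; [t]
   records in two elements of D which of the two pieces a point comes from. *)
have [[e [De einj]]|[g [gC ginj]]] := injection_comparable (~` D) D.
  pose r x := f (t `[< D x >]) (if `[< D x >] then x else e x).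
  have Dr x : D (if `[< D x >] then x else e x) by case: asboolP => // /De.
  have rinj x x' : r x = r x' -> x = x'.
    move=> /finj[]// /tinj.
    by do 2!case: asboolP => //; move=> Dx Dx' _; apply: einj; rewrite inE.
  have rD x : D (r x) by apply: Df => //; exact: Dr.
  exists (fun u => f (r u.1) (r u.2)) => -[x y] [x' y'] /finj[]//.
  by move=> /rinj /= -> /rinj /= ->.
exfalso.
(* [h] inverts [g] on the image of [D]; elsewhere it takes the default [i 0], which lies in [D]. *)
have /choice[h hP] : forall x, exists y, D (if `[< D x >] then x else y) /\
    (~ D x -> (exists2 z, D z & g z = x) -> g y = x).
  move=> x; have [[z Dz gz]|nx] := pselect (exists2 z, D z & g z = x).
    by exists z; split=> //; case: asboolP.
  exists (i 0%N); split=> [|_ /nx//]; case: asboolP => // _.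
  exact: (Dt false).
pose D' := D `|` [set g x | x in D].
pose r x := if `[< D x >] then x else h x.
have Dr x : D (r x) by have [] := hP x.
have rK x : D' x -> (if `[< D x >] then r x else g (r x)) = x.
  rewrite /r; case: asboolP => // nDx [//|[z Dz gz]]; have [_] := hP x.
  by apply=> //; exists z.
pose F x y := f (f (t `[< D x >]) (t `[< D y >])) (f (r x) (r y)).
have DF x y : D (F x y) by apply: (Df); apply: (Df).
pose f' x y := if `[< D x /\ D y >] then f x y else g (F x y).
have D'code : N `<=` D' /\ code D' f'.
  split; first by move=> x Nx; left; exact: ND.
  split=> [x y D'x D'y|x y x' y' D'x D'y D'x' D'y'].
    rewrite /f'; case: asboolP => [[? ?]|_]; first by left; exact: Df.
    by right; exists (F x y).
  rewrite /f'; case: asboolP => [[Dx Dy]|nD]; case: asboolP => [[Dx' Dy']|nD'].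
  - exact: finj.
  - by move=> E; have := gC _ (DF x' y'); rewrite -E => -[]; exact: Df.
  - by move=> E; have := gC _ (DF x y); rewrite E => -[]; exact: Df.
  - move=> /ginj; rewrite !inE => /(_ (DF _ _) (DF _ _)).
    move=> /finj[]; [exact: Df..|].
    move=> /finj[]// /tinj b1 /tinj b2 /finj[]// r1 r2.
    by rewrite -(rK x) // -(rK y) // -(rK x') // -(rK y') // b1 b2 r1 r2.
have := Dmax (exist _ (D', f') D'code); move=> /(_ _)/asboolP[].
  apply/asboolP; split=> /= [x Dx|x y Dx Dy]; first by left.
  by rewrite /f'; case: asboolP => // -[].
move=> /= D'D _; apply: (gC (i 0%N)); first exact: (Dt false).
by apply: D'D; right; exists (i 0%N) => //; exact: (Dt false).
Qed.

(** Iterated pairing is injective on sequences of a fixed length; pairing the result with the length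
    makes it injective on all sequences. *)
Lemma seq_injection T : infinite_set [set: T] ->
  exists f : seq T -> T, injective f.
Proof.
move=> infT; have [i iinj] := infinite_nat_injection infT.
have [f finj] := infinite_square_injection infT.
pose g := foldr (fun x y => f (x, y)) (i 0%N).
exists (fun s => f (i (size s), g s)) => s s' /finj[/iinj + +].
elim: s s' => [|x s IHs] [|x' s'] //= [ss'] /finj[-> gs].
by rewrite (IHs s').
Qed.

(** * Independent families and separated ultrafilters *)

Section UniformUltrafilters.
Variables (d : Order.disp_t) (eta : orderType d).
Hypothesis eta_infinite : infinite_set [set: eta].
Hypothesis eta_initial :
  forall al : eta, ~ ([set: eta] #<= [set be : eta | (be < al)%O])%card.

Let trace (X : set eta) (s : seq eta) := [seq x <- s | x \in X].

Lemma trace_separates (s : seq (set eta)) : exists t : seq eta,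
  forall X Y, X \in s -> Y \in s -> trace X t = trace Y t -> X = Y.
Proof.
have /choice[w wP] : forall XY : set eta * set eta, exists x : eta,
    XY.1 <> XY.2 -> ~ (XY.1 x <-> XY.2 x).
  have [x0 _] := infinite_setN0 eta_infinite.
  move=> [X Y] /=; have [->|] := pselect (X = Y); first by exists x0.
  move=> XY; apply: contrapT => H; apply/XY/seteqP; split=> x Zx;
    by apply: contrapT => nx; apply: H; exists x => _ [? ?]; tauto.
(* One point of the symmetric difference is collected for every pair of distinct members of [s]. *)
exists [seq w (X, Y) | X <- s, Y <- s] => X Y Xs Ys XY; apply: contrapT => nXY.
have := wP (X, Y) nXY; apply=> /=.
have ws : w (X, Y) \in [seq w (X, Y) | X <- s, Y <- s].
  by apply/allpairsP; exists (X, Y).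
have: (w (X, Y) \in trace X [seq w (X, Y) | X <- s, Y <- s]) =
  (w (X, Y) \in trace Y [seq w (X, Y) | X <- s, Y <- s]) by rewrite XY.
by rewrite !mem_filter ws !andbT => E; split=> /mem_set; [rewrite E|rewrite -E] => /set_mem.
Qed.

(* Fichtenholz-Kantorovich-Hausdorff. [B X] consists of the codes of triples
   [(x, t, l)] such that the trace of X on the finite set t is listed in l; the
   free coordinate x makes every Boolean combination as large as [eta], hence
   cofinal. *)
Lemma independent_family : exists B : set eta -> set eta,
  forall (s : seq (set eta)) (E : set (set eta)) (al : eta), exists be,
    [/\ (al <= be)%O, forall X, X \in s -> E X -> B X be
      & forall X, X \in s -> ~ E X -> ~ B X be].
Proof.
have [f finj] := seq_injection eta_infinite.
pose code x t l := f [:: x; f t; f (map f l)].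
have codeinj x t l x' t' l' :
    code x t l = code x' t' l' -> [/\ x = x', t = t' & l = l'].
  by move=> /finj[-> /finj-> /finj/(inj_map finj)->].
exists (fun X => [set be | exists x t l, be = code x t l /\ trace X t \in l]).
move=> s E al; have [t tP] := trace_separates s.
pose l := [seq trace X t | X <- s & X \in E].
(* Otherwise [x |-> code x t l] embeds [eta] in the initial segment below [al], against
   [eta_initial]. *)
have [x xal] : exists x, (al <= code x t l)%O.
  apply: contrapT => nx; apply: (@eta_initial al).
  apply: (@card_le_injective _ _ _ (fun x => code x t l)) => [x y /codeinj[]//|x /=].
  by rewrite ltNge; apply/negP => ?; apply: nx; exists x.
exists (code x t l); split=> // X Xs EX.
  exists x, t, l; split=> //; apply: map_f.
  by rewrite mem_filter Xs andbT inE.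
move=> [x' [t' [l' [/codeinj[_ <- <-] /mapP[Y]]]]].
rewrite mem_filter => /andP[/set_mem EY Ys] /(tP _ _ Xs Ys) XY.
by apply: EX; rewrite XY.
Qed.

(** [E] acts as a choice of signs: [F E u] is a final segment cut down by finitely many sets [B X]
    (for [X] in [E]) or their complements (otherwise). Independence makes these sets nonempty. An
    [X] lying in just one of [E] and [E'] provides the separating set. *)
Lemma separated_cofinal_ultrafilters : exists (p : set (set eta) -> set_system eta),
  (forall E, cofinal_ultrafilter (p E)) /\
  (forall E E', E <> E' -> exists B, p E B /\ p E' (~` B)).
Proof.
have [B Bindep] := independent_family.
pose F E (u : seq (set eta) * eta) : set eta :=
   [set be | [/\ (u.2 <= be)%O, forall X, X \in u.1 -> E X -> B X be
      & forall X, X \in u.1 -> ~ E X -> ~ B X be]].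
have FF E : ProperFilter (filter_from [set: _] (F E)).
  apply: filter_from_proper.
    have [x0 _] := infinite_setN0 eta_infinite.
    apply: filter_from_filter; first by exists ([::], x0).
    move=> [s al] [s' al'] _ _; exists (s ++ s', Order.max al al') => //.
    move=> be [/=]; rewrite ge_max => /andP[albe al'be] H H'.
    by split; split=> //= X Xs; (apply: H || apply: H'); rewrite mem_cat Xs ?orbT.
  by move=> [s al] _; have [be ?] := Bindep s E al; exists be.
have /choice[p pP] : forall E, exists G, UltraFilter G /\ filter_from [set: _] (F E) `<=` G.
  by move=> E; exact: ultraFilterLemma.
have pF E u : p E (F E u) by apply: (pP E).2; exists u.
exists p; split=> [E|E E' EE'].
  split; first exact: (pP E).1.
  move=> C pC al; have pU := (pP E).1.
  have [be [Cbe [/= albe _ _]]] := filter_ex (filterI pC (pF E ([::], al))).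
  by exists be.
have [x0 _] := infinite_setN0 eta_infinite.
have inp E0 X : E0 X -> p E0 (B X).
  move=> EX; have pU := (pP E0).1; apply: filterS (pF E0 ([:: X], x0)) => be [_ H _].
  by apply: H; rewrite ?mem_seq1.
have notinp E0 X : ~ E0 X -> p E0 (~` B X).
  move=> EX; have pU := (pP E0).1; apply: filterS (pF E0 ([:: X], x0)) => be [_ _ H].
  by apply: H; rewrite ?mem_seq1.
have [X [[EX E'X]|[EX E'X]]] : exists X, (E X /\ ~ E' X) \/ (~ E X /\ E' X).
  apply: contrapT => nX; apply/EE'/seteqP; split=> X ?; apply: contrapT => ?;
    by apply: nX; exists X; tauto.
  by exists (B X); split; [exact: inp|exact: notinp].
by exists (~` B X); split; [exact: notinp|rewrite setCK; exact: inp].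
Qed.

End UniformUltrafilters.

(** * The Hahn-Banach theorem *)

Section OfReal.
Variables (R : realType) (s : scalars).
Local Notation r := (@of_real R s).

Lemma of_real0 : r 0 = 0. Proof. by rewrite /of_real; case: s. Qed.
Lemma of_real1 : r 1 = 1. Proof. by rewrite /of_real; case: s. Qed.
Lemma of_realD : {morph r : x y / x + y}.
Proof. by move=> x y; rewrite /of_real; case: s => //=; exact: raddfD. Qed.
Lemma of_realN : {morph r : x / - x}.
Proof. by move=> x; rewrite /of_real; case: s => //=; exact: raddfN. Qed.
Lemma of_realM : {morph r : x y / x * y}.
Proof. by move=> x y; rewrite /of_real; case: s => //=; exact: rmorphM. Qed.

Lemma to_realD : {morph @to_real R s : x y / x + y}.
Proof. by rewrite /to_real; case: s => //= -[a b] [a' b']. Qed.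
Lemma to_realZ t (x : scalar_field R s) : to_real (r t * x) = t * to_real x.
Proof. by rewrite /to_real /of_real; case: s x => //= -[a b] /=; rewrite mul0r subr0. Qed.
Lemma to_real_norm (x : scalar_field R s) : to_real x <= to_real `|x|.
Proof.
rewrite /to_real; case: s x => //= [x|[a b] /=]; first exact: ler_norm.
by rewrite (le_trans (ler_norm a)) // -sqrtr_sqr ler_wsqrtr // lerDl sqr_ge0.
Qed.
Lemma ler_to_real (x y : scalar_field R s) : 0 <= x -> 0 <= y ->
  (to_real x <= to_real y) = (x <= y).
Proof. by move=> x0 y0; rewrite -(@ler_of_real _ s) !to_realK. Qed.
End OfReal.

Section HahnBanach.
Variables (R : realType) (s : scalars).
Local Notation K := (scalar_field R s).
Variable V : lmodType K.
Local Notation r := (@of_real R s).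

(** A complex space is treated as a real one through [of_real]. The inequality in the second clause,
    applied to [t^-1] as well, yields equality. *)
Definition sublinear (q : V -> R) :=
  (forall u v, q (u + v) <= q u + q v) /\
  (forall t v, 0 < t -> q (r t *: v) <= t * q v).

Lemma sublinear_hom q t v : sublinear q -> 0 < t -> q (r t *: v) = t * q v.
Proof.
move=> [_ qZ] t0; apply/eqP; rewrite eq_le qZ //= -ler_pdivlMl //.
have := qZ t^-1 (r t *: v); rewrite invr_gt0 => /(_ t0).
by rewrite scalerA -of_realM mulVf ?gt_eqF // of_real1 scale1r.
Qed.

Lemma sublinear0 q : sublinear q -> q 0 = 0.
Proof.
move=> sq; have := sublinear_hom 0 sq (ltr0Sn R 1); rewrite scaler0; lra.
Qed.

Lemma sublinear_oppr q v : sublinear q -> - q (- v) <= q v.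
Proof. by move=> sq; have := sq.1 v (- v); rewrite subrr sublinear0 //; lra. Qed.

(** The bound [lo] keeps the pointwise infimum finite, and the two remaining conditions pass to it.
    This serves both for chains of sublinear functionals and for lowering one functional along a
    vector or a graph. *)
Lemma sublinear_inf (I : Type) (D : set I) (h : I -> V -> R) (lo : V -> R) :
  D !=set0 -> (forall i v, D i -> lo v <= h i v) ->
  (forall i j u v, D i -> D j ->
     exists2 k, D k & h k (u + v) <= h i u + h j v) ->
  (forall i t v, D i -> 0 < t -> exists2 k, D k & h k (r t *: v) <= t * h i v) ->
  exists q, sublinear q /\ forall i v, D i -> q v <= h i v.
Proof.
move=> [i0 Di0] loh hD hZ; pose H v := [set h i v | i in D].
have H0 v : H v !=set0 by exists (h i0 v), i0.
have qh i v : D i -> inf (H v) <= h i v.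
  move=> Di; apply: ge_inf; last by exists i.
  by exists (lo v) => _ [j Dj <-]; exact: loh.
exists (fun v => inf (H v)); split=> //; split=> [u v|t v t0].
  rewrite -lerBlDr; apply: lb_le_inf => // _ [i Di <-].
  rewrite lerBlDl -lerBlDr; apply: lb_le_inf => // _ [j Dj <-].
  have [k Dk hk] := hD i j u v Di Dj.
  by have := qh _ (u + v) Dk; lra.
rewrite -ler_pdivrMl //; apply: lb_le_inf => // _ [i Di <-].
have [k Dk hk] := hZ i t v Di t0.
by rewrite ler_pdivrMl // (le_trans (qh _ _ Dk)).
Qed.

Lemma minimal_sublinear p : sublinear p -> exists q, [/\ sublinear q,
  forall v, q v <= p v &
  forall q', sublinear q' -> (forall v, q' v <= q v) -> forall v, q v <= q' v].
Proof.
move=> sp; pose Q := {q | sublinear q /\ forall v, q v <= p v}.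
pose le (q q' : Q) := `[< forall v, sval q' v <= sval q v >].
have [||F Ft|[q [sq qp]] qmin] := @ZL_preorder Q (exist _ p (conj sp (fun=> lexx _))) le.
- by move=> q; apply/asboolP.
- move=> q1 q2 q3 /asboolP q12 /asboolP q23; apply/asboolP => v.
  exact: le_trans (q23 v) (q12 v).
- have [F0|nF] := pselect (F !=set0); last first.
    by exists (exist _ p (conj sp (fun=> lexx _))) => q Fq; case: nF; exists q.
  (* The lower bound common to the chain comes from [- p (- v) <= - q (- v) <= q v] for [q] below
     [p]. *)
  have [||||q [sq qF]] := @sublinear_inf Q F (fun q => sval q) (fun v => - p (- v)).
  + exact: F0.
  + move=> q v _; have [sq qp] := svalP q.
    by rewrite (le_trans _ (sublinear_oppr _ sq)) // lerN2.
  + move=> q q' u v Fq Fq'; have [/asboolP qq'|/asboolP qq'] := Ft _ _ Fq Fq'.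
      exists q' => //; apply: le_trans ((svalP q').1.1 u v) _.
      by rewrite lerD2r.
    exists q => //; apply: le_trans ((svalP q).1.1 u v) _.
    by rewrite lerD2l.
  + by move=> q t v Fq t0; exists q => //; exact: (svalP q).1.2.
  have qp v : q v <= p v.
    by have [q0 Fq0] := F0; apply: le_trans (qF _ _ Fq0) ((svalP q0).2 v).
  exists (exist _ q (conj sq qp)) => q' Fq'; apply/asboolP => v /=.
  exact: qF.
exists q; split=> // q' sq' q'q.
have q'p v : q' v <= p v by exact: le_trans (q'q v) (qp v).
by have := qmin (exist _ q' (conj sq' q'p)) => /(_ (introT (asboolP _) q'q))/asboolP.
Qed.

Lemma minimal_sublinear_additive q : sublinear q ->
  (forall q', sublinear q' -> (forall v, q' v <= q v) -> forall v, q v <= q' v) ->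
  {morph q : u v / u + v}.
Proof.
move=> sq qmin v y; apply/eqP; rewrite eq_le sq.1 /=.
have qt t : 0 <= t -> q (r t *: y) = t * q y.
  rewrite le_eqVlt => /predU1P[<-|]; last exact: sublinear_hom.
  by rewrite of_real0 scale0r mul0r sublinear0.
(* By minimality q lies below the sublinear functional
   [v |-> inf_(t >= 0) (q (v + t y) - t q y)]; take t = 1. *)
have [||||q' [sq' q'h]] := @sublinear_inf R [set t | 0 <= t]
    (fun t v => q (v + r t *: y) - t * q y) (fun v => - q (- v)).
- by exists 0 => /=.
- move=> t u /= t0; rewrite -(qt t) //.
  by have := sq.1 (u + r t *: y) (- u); rewrite addrAC subrr add0r; lra.
- move=> t t' u w /= t0 t'0; exists (t + t'); rewrite /= ?addr_ge0 //.
  rewrite of_realD scalerDl [u + w + _]addrACA mulrDl.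
  by have := sq.1 (u + r t *: y) (w + r t' *: y); lra.
- move=> t t' u /= t0 t'0; exists (t' * t); first exact: mulr_ge0 (ltW t'0) t0.
  by rewrite of_realM -scalerA -scalerDr sublinear_hom // mulrBr mulrA.
have q'q u : q' u <= q u.
  by have := q'h 0 u (lexx 0); rewrite of_real0 scale0r addr0 mul0r subr0.
have := le_trans (qmin q' sq' q'q v) (q'h 1 v ler01).
by rewrite of_real1 scale1r mul1r lerBrDr.
Qed.

(** The functional to extend is given by its graph [G]. Domination makes the graph single-valued: if
    [(0, t)] is in [G], then [t <= p 0 = 0], and likewise for [- t]. *)
Lemma real_hahn_banach p (G : set (V * R)) : sublinear p ->
  G !=set0 -> (forall u v, G u -> G v -> G (u.1 + v.1, u.2 + v.2)) ->
  (forall t u, G u -> G (r t *: u.1, t * u.2)) ->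
  (forall u, G u -> u.2 <= p u.1) ->
  exists g : V -> R, [/\ {morph g : u v / u + v},
    forall t v, g (r t *: v) = t * g v, forall v, g v <= p v
    & forall u, G u -> g u.1 = u.2].
Proof.
move=> sp [u0 Gu0] GD GZ Gp.
have GN u : G u -> G (- u.1, - u.2).
  by move=> /(GZ (- 1)); rewrite of_realN of_real1 scaleN1r mulN1r.
have G0 : G (0, 0) by have := GZ 0 _ Gu0; rewrite of_real0 scale0r mul0r.
(* Any additive functional below [v |-> inf_(u in G) (p (v - u.1) + u.2)] agrees
   with G, as G is symmetric. *)
have [||||q [sq qG]] := @sublinear_inf _ G
  (fun u v => p (v - u.1) + u.2) (fun v => - p (- v)).
- by exists u0.
- move=> u v Gu; have := Gp _ (GN _ Gu) => /=.
  have := sp.1 (v - u.1) (- v); rewrite addrAC subrr add0r; lra.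
- move=> u u' v v' Gu Gu'; exists (u.1 + u'.1, u.2 + u'.2); first exact: GD.
  rewrite /= opprD [v + v' + _]addrACA.
  by have := sp.1 (v - u.1) (v' - u'.1); lra.
- move=> u t v Gu t0; exists (r t *: u.1, t * u.2); first exact: GZ.
  by rewrite /= -scalerBr sublinear_hom // mulrDr.
have [g [sg gq gmin]] := minimal_sublinear sq.
have gD := minimal_sublinear_additive sg gmin.
have gN v : g (- v) = - g v.
  by apply/eqP; rewrite -addr_eq0 addrC -gD subrr sublinear0.
have gG u : G u -> g u.1 <= u.2.
  move=> Gu; apply: (le_trans (gq _)); have := qG _ u.1 Gu.
  by rewrite subrr sublinear0 // add0r.
exists g; split=> //.
- move=> t v; have [t0|t0|->] := ltgtP t 0.
  + rewrite -[t in LHS]opprK of_realN scaleNr gN sublinear_hom ?oppr_gt0 //.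
    by rewrite mulNr opprK.
  + exact: sublinear_hom.
  + by rewrite of_real0 scale0r mul0r sublinear0.
- by move=> v; apply: (le_trans (gq _)); have := qG _ v G0; rewrite subr0 addr0.
move=> u Gu; apply/eqP; rewrite eq_le gG //=.
by have := gG _ (GN _ Gu); rewrite /= gN lerN2.
Qed.

End HahnBanach.

(** Over the complex numbers, [f v = g v - i g (i v)]. The last conclusion recovers a prescribed
    value of [f] from the real parts of all its scalar multiples. *)
Lemma scalar_linear_of_real_linear (R : realType) (s : scalars)
    (V : lmodType (scalar_field R s)) (P g : V -> R) :
  (forall k v, P (k *: v) = to_real `|k| * P v) ->
  {morph g : u v / u + v} -> (forall t v, g (of_real s t *: v) = t * g v) ->
  (forall v, g v <= P v) ->
  exists f : V -> scalar_field R s,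
    [/\ linear (f : V -> (scalar_field R s)^o), forall v, to_real `|f v| <= P v
      & forall v z, (forall k, g (k *: v) = to_real (k * z)) -> f v = z].
Proof.
move: V P g; case: s => V P g PZ gD gZ gP.
  exists g; split=> [k u v|v|v z /(_ 1)]; first by rewrite gD gZ.
    rewrite /to_real /= ler_norml gP andbT lerNl.
    have := gP (-1 *: v); rewrite gZ mulN1r; congr (_ <= _).
    by rewrite PZ /to_real /= normrN normr1 mul1r.
  by rewrite scale1r mul1r.
have gi u : g ('i%C *: ('i%C *: u)) = - g u.
  by have := gZ (-1) u; rewrite /of_real /= scalerA mulN1r => <-; congr (g (_ *: _)); simpc.
pose f v := (g v +i* - g ('i%C *: v))%C.
have fZ k v : f (k *: v) = k * f v.
  case: k => a b; have E w : g ((a +i* b)%C *: w) = a * g w + b * g ('i%C *: w).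
    rewrite -!gZ -gD /of_real /= scalerA -scalerDl; congr (g (_ *: _)).
    by simpc.
  have C : 'i%C *: ((a +i* b)%C *: v) = (a +i* b)%C *: ('i%C *: v).
    by rewrite !scalerA mulrC.
  rewrite /f C !E gi; simpc.
  by congr (_ +i* _)%C; ring.
have fD u v : f (u + v) = f u + f v.
  by rewrite /f scalerDr !gD; simpc; congr (_ +i* _)%C; ring.
exists f; split=> [k u v|v|v z Hv].
- by rewrite fD fZ.
- have [->|fv0] := eqVneq (f v) 0.
    rewrite normr0 /to_real /=.
    have := gP (-1 *: v); rewrite PZ normrN normr1 /to_real /= mul1r.
    have := gZ (-1) v; rewrite of_realN of_real1 => ->; have := gP v; lra.
  (* This unimodular [k] rotates [f v] onto its modulus, so that [f (k *: v)] is real and equals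
     [g (k *: v)]. *)
  pose k := `|f v| / f v.
  have k1 : `|k| = 1 by rewrite normrM normfV normr_id mulfV // normr_eq0.
  have := gP (k *: v); rewrite PZ k1 /to_real /= mul1r; congr (_ <= _).
  have -> : g (k *: v) = complex.Re (f (k *: v)) by [].
  by rewrite fZ /k mulfVK.
apply/eqP; rewrite eq_complex; case: z Hv => a b Hv /=; apply/andP; split; apply/eqP.
  by have := Hv 1; rewrite scale1r mul1r.
by rewrite Hv /to_real; simpc.
Qed.

(** The estimate makes [x j |-> c j] well defined on linear combinations, even if the [x j] are
    dependent. The real parts of the prescribed values form the graph fed to the real theorem. *)
Lemma hahn_banach_family (R : realType) (s : scalars)
    (V : lmodType (scalar_field R s)) (P : V -> R) (J : Type) (x : J -> V)
    (c : J -> scalar_field R s) :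
  (forall u v, P (u + v) <= P u + P v) ->
  (forall k v, P (k *: v) = to_real `|k| * P v) ->
  (forall n (j : 'I_n -> J) (z : 'I_n -> scalar_field R s),
     to_real `|\sum_(i < n) z i * c (j i)| <= P (\sum_(i < n) z i *: x (j i))) ->
  exists f : V -> scalar_field R s,
    [/\ linear (f : V -> (scalar_field R s)^o), forall v, to_real `|f v| <= P v
      & forall j, f (x j) = c j].
Proof.
move=> PD PZ Pc.
have subP : sublinear P.
  by split=> // t v t0; rewrite PZ ger0_norm ?of_realK // of_real_ge0 ltW.
pose comb n (j : 'I_n -> J) (z : 'I_n -> scalar_field R s) : V * scalar_field R s :=
  (\sum_(i < n) z i *: x (j i), \sum_(i < n) z i * c (j i)).
pose H := [set u | exists n j z, u = @comb n j z].
have HD u v : H u -> H v -> H (u.1 + v.1, u.2 + v.2).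
  move=> [n [j [z ->]]] [n' [j' [z' ->]]].
  exists (n + n')%N, (fun i => match fintype.split i with inl l => j l | inr l => j' l end),
    (fun i => match fintype.split i with inl l => z l | inr l => z' l end).
  rewrite /comb !big_split_ord /=; congr (_ + _, _ + _); apply: eq_bigr => i _;
    by rewrite ?(unsplitK (inl i)) ?(unsplitK (inr i)).
have HZ k u : H u -> H (k *: u.1, k * u.2).
  move=> [n [j [z ->]]]; exists n, j, (fun i => k * z i).
  rewrite /comb /= scaler_sumr mulr_sumr; congr (_, _); apply: eq_bigr => i _.
    by rewrite scalerA.
  by rewrite mulrA.
have Hx j : H (x j, c j).
  exists 1%N, (fun=> j), (fun=> 1).
  by rewrite /comb !big_ord1 scale1r mul1r.
have [||||g [gD gZ gP gH]] :=
  @real_hahn_banach R s V P [set (u.1, to_real u.2) | u in H] subP.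
- exists (0, @to_real R s 0); exists (0, 0) => //.
  exists 0%N, (fun i : 'I_0 => False_rect J (notF (ltn_ord i))), (fun=> 0).
  by rewrite /comb !big_ord0.
- move=> _ _ [u Hu <-] [v Hv <-]; exists (u.1 + v.1, u.2 + v.2) => /=; first exact: HD.
  by rewrite to_realD.
- move=> t _ [u Hu <-]; exists (of_real s t *: u.1, of_real s t * u.2) => /=; first exact: HZ.
  by rewrite to_realZ.
- move=> _ [_ [n [j [z ->]]] <-] /=; apply: le_trans (Pc n j z).
  exact: to_real_norm.
have {}gH u : H u -> g u.1 = to_real u.2.
  by move=> Hu; apply: (gH (u.1, to_real u.2)); exists u.
have [f [fl fP fg]] := scalar_linear_of_real_linear PZ gD gZ gP.
exists f; split=> // j; apply: fg => k.
exact: (gH (k *: x j, k * c j) (HZ k _ (Hx j))).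
Qed.

(** Hahn-Banach on the power ['I_m -> A] for the l1-norm of the coordinates scaled by [M]; the
    functional obtained is the sum of its restrictions to the coordinates. *)
Lemma dual_interpolation (R : realType) (s : scalars)
    (A : normedModType (scalar_field R s)) (m : nat) (M : scalar_field R s)
    (J : Type) (x : J -> 'I_m -> A) (c : J -> scalar_field R s) :
  0 <= M ->
  (forall n (j : 'I_n -> J) (z : 'I_n -> scalar_field R s),
     `|\sum_(i < n) z i * c (j i)| <=
     M * \sum_(k < m) `|\sum_(i < n) z i *: x (j i) k|) ->
  exists S : 'I_m -> dual A, forall j, \sum_(k < m) S k (x j k) = c j.
Proof.
move=> M0 cM; pose K := scalar_field R s.
pose P (v : 'I_m -> A) := to_real (M * \sum_(k < m) `|v k|).
have sum0 (v : 'I_m -> A) : 0 <= M * \sum_(k < m) `|v k|.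
  by rewrite mulr_ge0 // sumr_ge0.
have [u v|k v|n j z|f [fl fP fc]] := @hahn_banach_family R s _ P J x c.
- rewrite -to_realD ler_to_real ?addr_ge0 //.
  rewrite -mulrDr ler_wpM2l // -big_split ler_sum // => k _.
  exact: ler_normD.
- rewrite /P -to_realZ to_realK // mulrCA; congr (to_real (_ * _)).
  by rewrite mulr_sumr; apply: eq_bigr => l _; rewrite normrZ.
- rewrite ler_to_real //; apply: le_trans (cM n j z) _.
  rewrite le_eqVlt; apply/predU1P; left; congr (_ * _); apply: eq_bigr => k _.
  by rewrite fct_sumE.
pose F : {linear ('I_m -> A) -> K^o} := HB.pack f (GRing.isLinear.Build _ _ _ _ f fl).
pose d k (a : A) : 'I_m -> A := fun l => if l == k then a else 0.
have dl k (t : K) a b : d k (t *: a + b) = t *: d k a + d k b.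
  apply/funext => l; rewrite /d !fctE.
  by case: ifP => //; rewrite scaler0 addr0.
have fb k : is_bounded_linear (fun a => f (d k a) : K^o).
  split=> [t a b|]; first by rewrite dl fl.
  exists M => a; rewrite -ler_to_real ?mulr_ge0 //.
  apply: le_trans (fP _) _; rewrite /P (bigD1 k) //= {1}/d eqxx big1 ?addr0 //.
  by move=> l lk; rewrite /d (negbTE lk) normr0.
exists (fun k => mk_blin (fb k)) => j; rewrite -fc /=.
rewrite -[RHS]/(F (x j)) [in RHS](_ : x j = \sum_(k < m) d k (x j k)).
  by rewrite raddf_sum.
apply/funext => l; rewrite fct_sumE (bigD1 l) //= {1}/d eqxx big1 ?addr0 //.
by move=> k kl; rewrite /d eq_sym (negbTE kl).
Qed.

(** * Limits of functionals along ultrafilters *)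

Lemma ultrafilter_fmap (T U : Type) (f : T -> U) (F : set_system T) :
  UltraFilter F -> UltraFilter (f @ F).
Proof.
move=> FU; split=> [|G GP FG]; first exact: fmap_proper_filter.
apply/seteqP; split=> // B GB; have [//|FnB] := in_ultra_setVsetC (f @^-1` B) FU.
have /FG GnB : (f @ F) (~` B) by [].
by have [x []] := filter_ex (filterI GB GnB).
Qed.

Lemma real_ultralimit (R : realType) (J : Type) (U : set_system J) (x : J -> R) M :
  UltraFilter U -> (forall j, `|x j| <= M) -> exists l : R, x @ U --> l.
Proof.
move=> UU xM; have := @segment_compact R (- M) M; rewrite compact_ultra.
move=> /(_ _ (ultrafilter_fmap x UU))[]; last by move=> l [_ xl]; exists l.
have : U [set j | x j \in `[- M, M]] by apply: filterE => j /=; rewrite in_itv /= -ler_norml.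
by [].
Qed.

Lemma scalar_ultralimit (R : realType) (s : scalars) (J : Type)
    (U : set_system J) (z : J -> (scalar_field R s)^o) (M : scalar_field R s) :
  UltraFilter U -> (forall j, `|z j| <= M) ->
  exists l : (scalar_field R s)^o, z @ U --> l.
Proof.
move: z M; case: s => z M UU zM; first exact: real_ultralimit zM.
have reM (w : R[i]) : `|w| <= M -> `|complex.Re w| <= complex.Re M.
  by move=> /(le_trans (normc_ge_Re w)); rewrite lecE => /andP[].
have [a ra] := real_ultralimit UU (fun j => reM _ (zM j)).
have imM j : `|complex.Im (z j)| <= complex.Re M.
  rewrite -normrN; have -> : - complex.Im (z j) = complex.Re ('i%C * (z j : R[i])).
    by case: (z j) => x y; simpc.
  by apply: reM; rewrite normrM normc_def /= expr0n expr1n add0r sqrtr1 mul1r.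
have [b rb] := real_ultralimit UU imM.
have normC (t : R) : `|t%:C%C| = `|t|%:C%C :> R[i].
  by rewrite normc_def /= expr0n addr0 sqrtr_sqr.
exists (a +i* b)%C; apply/cvgrPdist_lt => e e0.
have := e0; rewrite ltcE /= => /andP[/eqP e2 e1].
have e3 : 0 < complex.Re e / 2 by rewrite divr_gt0.
have /cvgrPdist_lt/(_ _ e3) A1 := ra; have /cvgrPdist_lt/(_ _ e3) A2 := rb.
apply: filterS2 A1 A2 => j A1 A2.
have -> : (a +i* b)%C - z j =
    (a - complex.Re (z j))%:C%C + 'i%C * (b - complex.Im (z j))%:C%C :> R[i].
  by case: (z j) => x y; simpc.
apply: le_lt_trans (ler_normD _ _) _.
rewrite normrM !normC normc_def /= expr0n expr1n add0r sqrtr1 mul1r.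
rewrite -raddfD ltcE /= -e2 eqxx /=; move: A1 A2 => /=; lra.
Qed.

(** Banach-Alaoglu in ultrafilter form: bounded scalars converge along [U], and linearity and the
    bound pass to the pointwise limit. *)
Lemma dual_ultralimit (R : realType) (s : scalars)
    (V : normedModType (scalar_field R s)) (J : Type) (U : set_system J)
    (phi : J -> dual V) (M : scalar_field R s) :
  UltraFilter U -> (forall j v, `|phi j v| <= M * `|v|) ->
  exists psi : dual V, (forall v, `|psi v| <= M * `|v|) /\
    forall v, phi j v @[j --> U] --> psi v.
Proof.
move=> UU phiM.
have /choice[psi psiP] : forall v,
    exists l : (scalar_field R s)^o, phi j v @[j --> U] --> l.
  by move=> v; exact: scalar_ultralimit (phiM^~ v).
have psiM v : `|psi v| <= M * `|v|.
  apply/ler_addgt0Pr => e e0; have /cvgrPdist_lt/(_ _ e0) near := psiP v.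
  have [j /= je] := filter_ex near.
  rewrite -[psi v](subrK (phi j v)) (le_trans (ler_normD _ _)) //.
  by rewrite [leRHS]addrC; apply: lerD; [exact: ltW je|exact: phiM].
have psil : is_bounded_linear psi.
  split=> [k u v|]; last by exists M.
  apply: (@cvg_unique _ (@norm_hausdorff _ _) (phi j (k *: u + v) @[j --> U])).
    exact: psiP.
  have -> : (fun j => phi j (k *: u + v)) = (fun j => k *: phi j u + phi j v).
    by apply/funext => j; rewrite (blin_linear (phi j)).
  by apply: cvgD; [apply: cvgZr|]; exact: psiP.
by exists (mk_blin psil).
Qed.

(** [rho f] is the limit of [f (T (e j))] along an ultrafilter refining the approximate identity. On
    [S . a] the values are [S (a T(e j)) = S (T (a e j))], which tend to [S (T a)]. As [M] does not
    depend on [T], bounded families of multipliers give bounded families of functionals. *)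
Lemma multiplier_functional_exists (R : realType) (s : scalars)
    (A : banachAlgType (scalar_field R s)) :
  has_bounded_approximate_identity A ->
  exists2 M : scalar_field R s, 0 <= M & forall T : blin A A, right_multiplier T ->
    exists rho : dual (LUC A), multiplier_functional T rho /\
      forall f, `|rho f| <= `|T| * M * `|f|.
Proof.
move=> [J [F [e [FF /pinfty_ex_gt0[M M0 eM] eR _]]]].
have [U [UU FU]] := ultraFilterLemma FF.
exists M; first exact: ltW.
move=> T Tr.
have phib j : is_bounded_linear (fun f : LUC A => luc_fun f (T (e j)) : (scalar_field R s)^o).
  split=> [k f g|]; first by [].
  by exists `|T (e j)| => f; rewrite mulrC; exact: blin_norm_le.
have phiM j f : `|mk_blin (phib j) f| <= `|T| * M * `|f|.
  rewrite mulrC /=; apply: le_trans (blin_norm_le _ _) _; rewrite ler_wpM2l //.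
  apply: le_trans (blin_norm_le _ _) _; rewrite ler_wpM2l //.
  exact: eM.
have [rho [rhoM rhol]] := dual_ultralimit UU phiM.
exists rho; split=> // S a.
apply: (@cvg_unique _ (@norm_hausdorff _ _) (mk_blin (phib j) (luc_act S a) @[j --> U])).
  exact: rhol.
apply/cvgrPdist_lt => r r0 /=.
have C0 : 0 < `|S| * `|T| + 1 by rewrite ltr_wpDl // mulr_ge0.
have /cvgrPdist_lt/(_ _ (divr_gt0 r0 C0)) near := eR a.
apply: filterS (FU _ near) => j /= H.
rewrite -Tr -!linearB /=; apply: le_lt_trans (blin_norm_le _ _) _.
have : `|S| * `|T (a - amul a (e j))| <= (`|S| * `|T| + 1) * `|a - amul a (e j)|.
  rewrite mulrDl mul1r -mulrA; apply: ler_wpDr => //.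
  by rewrite ler_wpM2l // blin_norm_le.
by move=> /le_lt_trans; apply; rewrite mulrC -ltr_pdivlMr.
Qed.

Lemma weak_star_limit_exists (R : realType) (s : scalars)
    (A : banachAlgType (scalar_field R s)) (d : Order.disp_t) (eta : orderType d)
    (a : eta -> blin A A) (p : set_system eta) :
  has_bounded_approximate_identity A -> bounded_multipliers a ->
  UltraFilter p -> exists Psi, weak_star_limit p a Psi.
Proof.
move=> /multiplier_functional_exists[M M0 H] [ar /pinfty_ex_gt0[N N0 aN]] pU.
have /choice[rho rhoP] al := H (a al) (ar al).
have rhoM al f : `|rho al f| <= N * M * `|f|.
  apply: le_trans ((rhoP al).2 f) _; rewrite ler_wpM2r // ler_wpM2r //.
  exact: aN.
have [Psi [_ PsiP]] := dual_ultralimit pU rhoM.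
by exists Psi, rho; split=> // al; exact: (rhoP al).1.
Qed.

Lemma weak_star_limit_act (R : realType) (s : scalars)
    (A : banachAlgType (scalar_field R s)) (d : Order.disp_t) (eta : orderType d)
    (a : eta -> blin A A) (p : set_system eta) (Psi : dual (LUC A)) :
  weak_star_limit p a Psi ->
  forall (S : dual A) x, S (a al x) @[al --> p] --> lucdual_act Psi S x.
Proof.
move=> [rho [rhoP rhol]] S x.
have -> : (fun al => S (a al x)) = (fun al => rho al (luc_act S x)).
  by apply/funext => al; rewrite rhoP.
exact: rhol.
Qed.

(** * Spans and functionals *)

(** The base inequalities concern distinct indices, whereas the interpolation condition allows
    repetitions; sums over [j] are therefore regrouped along the fibres of [h]. *)
Lemma injective_regroup (J : eqType) n (j : 'I_n -> J) :
  exists N (y : 'I_N -> J) (h : 'I_n -> 'I_N),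
    [/\ injective y, forall i, y (h i) = j i & forall l, exists i, h i = l].
Proof.
pose s := undup (codom j).
have js i : j i \in s by rewrite mem_undup codom_f.
have ljs i : (index (j i) s < size s)%N by rewrite index_mem.
exists (size s), (tnth (in_tuple s)), (fun i => Ordinal (ljs i)).
have yh i : tnth (in_tuple s) (Ordinal (ljs i)) = j i.
  by rewrite (tnth_nth (j i)) /= nth_index.
have yinj : injective (tnth (in_tuple s)) by apply/tuple_uniqP; rewrite /= undup_uniq.
split=> // l; have : tnth (in_tuple s) l \in codom j.
  by rewrite -mem_undup mem_tnth.
by move=> /codomP[i ji]; exists i; apply: yinj; rewrite yh.
Qed.

Section Functionals.
Variables (R : realType) (s : scalars).
Local Notation K := (scalar_field R s).

Lemma span0 (V : normedModType K) (E : set V) : span E 0.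
Proof. by exists 0%N, (fun=> 0), (fun=> 0); split=> [[]//|]; rewrite big_ord0. Qed.

Lemma span_sum (V : normedModType K) (E : set V) (I : Type) (r : seq I) (P : pred I)
    (F : I -> V) :
  (forall i, P i -> span E (F i)) -> span E (\sum_(i <- r | P i) F i).
Proof.
move=> EF; apply: big_ind => //; first exact: span0.
by move=> x y Ex Ey; rewrite -[x]scale1r; exact: span_linear.
Qed.

Lemma span_scale (V : normedModType K) (E : set V) (t : K) x :
  E x -> span E (t *: x).
Proof. by move=> Ex; exists 1%N, (fun=> t), (fun=> x); rewrite big_ord1. Qed.

Lemma blin_sumE (V W : normedModType K) n (F : 'I_n -> blin V W) x :
  (\sum_(i < n) F i) x = \sum_(i < n) F i x.
Proof. by elim/big_rec2: _ => [//|i y f _ <-]. Qed.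

Lemma dual_eq_dense (V : normedModType K) (E : set V) (F G : dual V) :
  closure (span E) = setT -> (forall x, E x -> F x = G x) -> F = G.
Proof.
move=> Edense FG; apply/val_inj/funext => x /=; apply/eqP; rewrite -subr_eq0.
have FGspan y : span E y -> F y = G y.
  move=> [n [c [v [Ev ->]]]]; rewrite !linear_sum; apply: eq_bigr => i _.
  by rewrite !linearZ /= FG.
have H y : (F - G) y = F y - G y by [].
rewrite -H -normr_le0; apply/ler_addgt0Pr => e e0; rewrite add0r.
have /closure_normP : closure (span E) x by rewrite Edense.
have C0 : 0 < `|F - G| + 1 by rewrite ltr_wpDl.
move=> /(_ _ (divr_gt0 e0 C0))[y Ey xy].
have -> : (F - G) x = (F - G) (x - y).
  have FGy : (F - G) y = 0 by rewrite H FGspan // subrr.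
  have := blin_linear (F - G) (-1) y x.
  by rewrite FGy scaler0 add0r scaleN1r [- y + x]addrC => ->.
apply: le_trans (blin_norm_le _ _) _.
apply: (@le_trans _ _ ((`|F - G| + 1) * `|x - y|)).
  by rewrite ler_wpM2r // lerDl.
by rewrite mulrC -ler_pdivlMr // ltW.
Qed.

Lemma dual_nonzero (V : normedModType K) (a : V) : a != 0 ->
  exists T : dual V, T a != 0.
Proof.
move=> a0; have [|n j z|S /(_ tt)] :=
  @dual_interpolation R s V 1 `|a|^-1 unit (fun=> fun=> a) (fun=> 1).
- by rewrite invr_ge0.
- rewrite big_ord1 -mulr_suml mulr1 -scaler_suml normrZ mulrCA mulVf ?mulr1 //.
  by rewrite normr_eq0.
by rewrite big_ord1 => Sa; exists (S ord0); rewrite Sa oner_eq0.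
Qed.

Variable A : banachAlgType K.

(** [lucP] gives approximants in the dual of [A]; lifted to LUC(A), they show that the [S . a] span
    a dense subspace there. *)
Lemma luc_functional_nonzero (Phi : dual (LUC A)) : Phi != 0 ->
  exists T a, Phi (luc_act T a) != 0.
Proof.
move=> Phi0; apply: contrapT => Phi_act; case/eqP: Phi0.
have actE T a : Phi (luc_act T a) = 0.
  by apply/eqP; apply: contrapT => /negP H; apply: Phi_act; exists T, a.
apply: (@dual_eq_dense _ [set luc_act u.1 u.2 | u in [set: dual A * A]]); last first.
  by move=> _ [u _ <-]; rewrite actE.
apply/seteqP; split=> // f _; apply/closure_normP => e e0.
have /asboolP/closure_normP/(_ e e0)[T [n [c [v [vE ->]]]] fT] := lucP f.
have /choice[u uE] : forall i, exists u : dual A * A, v i = dual_act u.1 u.2.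
  by move=> i; have [S [a va]] := vE i; exists (S, a).
exists (\sum_(i < n) c i *: luc_act (u i).1 (u i).2).
  by exists n, c, (fun i => luc_act (u i).1 (u i).2); split=> // i; exists (u i).
suff E : luc_fun (\sum_(i < n) c i *: luc_act (u i).1 (u i).2) = \sum_(i < n) c i *: v i.
  by move: fT; rewrite -E.
elim/big_rec2: _ => // i x y _ <-.
by rewrite uE.
Qed.
End Functionals.

(** * Interpolation over an F-l1-base *)

Lemma ord_eq m (k l : 'I_m) : m = 1%N -> k = l.
Proof. by move=> m1; move: k l; rewrite m1 => k l; rewrite !ord1. Qed.

Section Separation.
Variables (R : realType) (s : scalars).
Local Notation K := (scalar_field R s).
Variables (A : banachAlgType K) (d : Order.disp_t) (eta : orderType d) (m : nat).
Variables (A_ : eta -> set A) (a_ : 'I_m -> eta -> blin A A).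

(** In the second clause [j] and [k] vary independently: cluster points of two ultrafilters may
    coincide under different indices, and each [S k] has to be killed by all of them. *)
Definition separating := forall (T : dual A) (B : set eta), exists S : 'I_m -> dual A,
  (forall al a, B al -> A_ al a -> \sum_(k < m) S k (a_ k al a) = T a) /\
  (forall al a j k, ~ B al -> A_ al a -> S k (a_ j al a) = 0).

(** On an l1-base any bounded prescription of values can be interpolated. The prescription [c] is
    bounded by [|T| * C], where [C] bounds the [A_ al]. *)
Lemma Fl1_base1_separating : Fl1_base1 A_ a_ -> separating.
Proof.
move=> [m1 base] T B; pose D := {q : eta * A | A_ q.1 q.2}.
have k0 : 'I_m by rewrite m1; exact: ord0.
have [[[_ /pinfty_ex_gt0[C C0 AC] _] _ _] [_ _ [K0 K00 K0P]]] := base k0.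
have kE k : k = k0 := ord_eq k k0 m1.
have sumE (W : zmodType) (F : 'I_m -> W) : \sum_(k < m) F k = F k0.
  by rewrite (bigD1 k0) //= big1 ?addr0 // => k; rewrite (kE k) eqxx.
pose c (q : eta * A) : K := if `[< B q.1 >] then T q.2 else 0.
have M0 : 0 <= `|T| * C * K0 by rewrite !mulr_ge0 // ltW.
have [n j z|S SP] := @dual_interpolation R s A m _ D
    (fun q k => a_ k (sval q).1 (sval q).2) (fun q => c (sval q)) M0; last first.
  exists S; split=> [al a Bal Aa|al a j k Bal Aa].
    have := SP (exist _ (al, a) Aa); rewrite /c /=.
    by case: asboolP.
  have := SP (exist _ (al, a) Aa); rewrite /c /= sumE (kE j) (kE k).
  by case: asboolP.
rewrite sumE.
have [N [y [h [yinj yh hsurj]]]] := injective_regroup (fun i => sval (j i)).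
have part (W : zmodType) (F : 'I_n -> W) :
    \sum_(i < n) F i = \sum_(l < N) \sum_(i < n | h i == l) F i.
  exact: (partition_big h predT).
have Dy l : A_ (y l).1 (y l).2.
  by have [i <-] := hsurj l; rewrite yh; exact: svalP (j i).
have cC q : A_ q.1 q.2 -> `|c q| <= `|T| * C.
  move=> Aq; rewrite /c; case: asboolP => _; last by rewrite normr0 mulr_ge0 // ltW.
  apply: le_trans (blin_norm_le _ _) _; rewrite ler_wpM2l //.
  by apply: AC; exists q.1.
pose w l := \sum_(i < n | h i == l) z i.
have -> : \sum_(i < n) z i * c (sval (j i)) = \sum_(l < N) w l * c (y l).
  rewrite part; apply: eq_bigr => l _; rewrite /w mulr_suml; apply: eq_bigr => i /eqP <-.
  by rewrite yh.
have -> : \sum_(i < n) z i *: a_ k0 (sval (j i)).1 (sval (j i)).2 =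
    \sum_(l < N) w l *: a_ k0 (y l).1 (y l).2.
  rewrite part; apply: eq_bigr => l _; rewrite /w scaler_suml; apply: eq_bigr => i /eqP <-.
  by rewrite yh.
apply: le_trans (ler_norm_sum _ _ _) _; rewrite -[leRHS]mulrA.
apply: (@le_trans _ _ (`|T| * C * \sum_(l < N) `|w l|)).
  rewrite mulr_sumr ler_sum // => l _; rewrite normrM mulrC ler_wpM2r //.
  exact: cC.
rewrite ler_wpM2l ?(mulr_ge0 _ (ltW C0)) //; exact: (K0P _ y).
Qed.

Lemma Fl1_base2_base3 : Fl1_base2 A_ a_ -> Fl1_base3 A_ a_.
Proof.
move=> [m1 base].
have k0 : 'I_m by rewrite m1; exact: ord0.
have kE k : k = k0 := ord_eq k k0 m1.
have [[Aex _ _] sel [K2 K20 K2P]] := base k0.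
split=> // [k|k||].
- by have [[]] := base k.
- by have [[]] := base k.
- rewrite (_ : (fun al => _) = (fun al => a_ k0 al @` A_ al)) //.
  apply/funext => al; apply/seteqP; split=> [x [k _]|x ax]; first by rewrite (kE k).
  by exists k0.
exists K2 => // al a Aa; rewrite (bigD1 k0) //= big1 ?addr0; first exact: K2P.
by move=> k; rewrite (kE k) eqxx.
Qed.

Lemma Fl1_base3_separating : Fl1_base3 A_ a_ -> separating.
Proof.
move=> [_ _ _ [_ _ _ [K1 K10 K1P]] [K2 K20 K2P]] T B.
(* At [(al, a)] the index [None] carries the condition
   [sum_k S k (a_ k al a) = T a], required when [B al], and [Some (j, l)] the
   condition [S l (a_ j al a) = 0], required otherwise. *)
pose D := ({q : eta * A | A_ q.1 q.2} * option ('I_m * 'I_m))%type.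
pose al (q : D) := (sval q.1).1; pose ai (q : D) := (sval q.1).2.
pose x (q : D) k : A := match q.2 with
  | None => if `[< B (al q) >] then a_ k (al q) (ai q) else 0
  | Some (j, l) => if `[< B (al q) >] then 0 else if k == l then a_ j (al q) (ai q) else 0
  end.
pose e (q : D) : K := if `[< B (al q) >] && (q.2 == None) then 1 else 0.
(* The factors come from evaluating [T] at each block, from bounding a block by its images under the
   multipliers, and from splitting a sum over distinct blocks. *)
have M0 : 0 <= `|T| * K2 * K1 by rewrite !mulr_ge0 // ltW.
have [n j z|S SP] := @dual_interpolation R s A m _ D x (fun q => e q * T (ai q)) M0; last first.
  exists S; split=> [be a Bbe Aa|be a j k Bbe Aa].
    have := SP (exist _ (be, a) Aa, None); rewrite /e /x /al /ai /=.
    by case: asboolP => // _; rewrite mul1r.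
  have := SP (exist _ (be, a) Aa, Some (j, k)); rewrite /e /x /al /ai /=.
  case: asboolP => // _; rewrite mul0r (bigD1 k) //= eqxx big1 ?addr0 //.
  by move=> l /negbTE ->; rewrite linear0.
have [N [y [h [yinj yh hsurj]]]] := injective_regroup (al \o j).
have part (W : zmodType) (F : 'I_n -> W) :
    \sum_(i < n) F i = \sum_(l < N) \sum_(i < n | h i == l) F i.
  exact: (partition_big h predT).
pose b l := \sum_(i < n | h i == l) (z i * e (j i)) *: ai (j i).
pose v l k := \sum_(i < n | h i == l) z i *: x (j i) k.
have Aj i : A_ (al (j i)) (ai (j i)) by exact: svalP (j i).1.
have bA l : span (A_ (y l)) (b l).
  apply: span_sum => i /eqP <-; rewrite yh; exact: (span_scale _ (Aj i)).
(* Through the indices [Some (j, k)], coordinate [k] may contain images under any [a_ j]; hence the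
   span of the union over all multipliers. *)
have vL l k : span (\bigcup_k (a_ k (y l) @` A_ (y l))) (v l k).
  apply: span_sum => i /eqP <-; rewrite yh /= /x.
  have sp0 (E : set A) : span E (z i *: (0 : A)).
    by rewrite scaler0; exact: span0.
  case: (j i).2 (Aj i) => [[k1 l1]|] Aji; case: asboolP => _ //=.
    by case: ifP => // _; apply: span_scale; exists k1 => //; exists (ai (j i)).
  by apply: span_scale; exists k => //; exists (ai (j i)).
(* On [B] only the indices [None] contribute, and the block is the image of the single vector [b l];
   off [B] that vector is 0. In both cases [K2] controls [b l]. *)
have vB l k : B (y l) -> v l k = a_ k (y l) (b l).
  move=> By; rewrite linear_sum /v; apply: eq_bigr => i /eqP hi.
  have ali : al (j i) = y l by rewrite -hi yh.
  rewrite linearZ /= -scalerA; congr (_ *: _); rewrite /x /e ali.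
  case: asboolP => // _; case: (j i).2 => [[k1 l1]|] /=; by rewrite ?scale0r ?scale1r.
have bB l : ~ B (y l) -> b l = 0.
  move=> By; rewrite /b big1 // => i /eqP hi.
  have ali : al (j i) = y l by rewrite -hi yh.
  by rewrite /e ali; case: asboolP => // _; rewrite mulr0 scale0r.
have bv l : `|b l| <= K2 * \sum_(k < m) `|v l k|.
  have [By|nBy] := pselect (B (y l)); last first.
    by rewrite bB // normr0 mulr_ge0 ?(ltW K20) // sumr_ge0.
  under eq_bigr do rewrite vB //; exact: K2P.
have -> : \sum_(i < n) z i * (e (j i) * T (ai (j i))) = \sum_(l < N) T (b l).
  rewrite part; apply: eq_bigr => l _; rewrite linear_sum; apply: eq_bigr => i _.
  by rewrite linearZ /= mulrA.
have -> : \sum_(k < m) `|\sum_(i < n) z i *: x (j i) k| =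
    \sum_(k < m) `|\sum_(l < N) v l k|.
  by apply: eq_bigr => k _; rewrite part.
apply: le_trans (ler_norm_sum _ _ _) _; rewrite -!mulrA.
apply: (@le_trans _ _ (`|T| * \sum_(l < N) `|b l|)).
  by rewrite mulr_sumr ler_sum // => l _; exact: blin_norm_le.
rewrite ler_wpM2l //.
apply: (@le_trans _ _ (K2 * \sum_(k < m) \sum_(l < N) `|v l k|)).
  rewrite exchange_big /= mulr_sumr ler_sum // => l _; exact: bv.
rewrite ler_wpM2l ?(ltW K20) // mulr_sumr ler_sum // => k _.
exact: (K1P _ y).
Qed.
End Separation.

(** * Right cancellation *)

(** Common to both algebras. The ranges of the [psi i] are the cancellable sets, singletons when
    [m = 1]; the third hypothesis makes distinct indices give distinct ranges. *)
Lemma right_cancellable_card (X : zmodType) (mul : X -> X -> X) (S : set X)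
    (I : Type) m (psi : I -> 'I_m -> X) :
  (forall i k, S (psi i k)) ->
  (forall i x, x != 0 -> exists k, mul x (psi i k) != 0) ->
  (forall i i', (forall k, exists l, psi i k = psi i' l) -> i = i') ->
  (m = 1%N -> ([set: I] #<= [set x | right_cancellable_in mul S [set x]])%card) /\
  ([set: I] #<= [set G | right_cancellable_in mul S G])%card.
Proof.
move=> Spsi psi0 psi_inj; split.
  move=> m1; move: psi Spsi psi0 psi_inj; rewrite m1 => psi Spsi psi0 psi_inj.
  apply: (@card_le_injective _ _ _ (fun i => psi i ord0)) => [i i' ii'|i].
    by apply: psi_inj => k; exists ord0; rewrite ord1.
  split=> [_ -> //|x _ /(psi0 i)[k xk]].
  by exists (psi i k) => //=; rewrite ord1.
apply: (@card_le_injective _ _ _ (fun i => range (psi i))) => [i i' ii'|i].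
  apply: psi_inj => k; have : range (psi i) (psi i k) by exists k.
  by rewrite ii' => -[l _ <-]; exists l.
split=> [_ [k _ <-] //|x _ /(psi0 i)[k xk]].
by exists (psi i k) => //; exists k.
Qed.

Section ClusterPoints.
Variables (R : realType) (s : scalars).
Local Notation K := (scalar_field R s).
Variables (A : banachAlgType K) (d : Order.disp_t) (eta : orderType d) (m : nat).
Variables (A_ : eta -> set A) (a_ : 'I_m -> eta -> blin A A).
Hypothesis A_exh : exhausting A_.

(** For [x] in [A_ al0], cofinality puts the final segment from [al0] in [p]. On its intersection
    with [B], monotonicity gives [x] in [A_ al], so the sum is constantly [T x]; density of the span
    then gives equality everywhere. *)
Lemma weak_star_limit_sum (p : set_system eta) (psi : 'I_m -> dual (LUC A))
    (B : set eta) (S : 'I_m -> dual A) (T : dual A) :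
  cofinal_ultrafilter p -> (forall k, weak_star_limit p (a_ k) (psi k)) -> p B ->
  (forall al a, B al -> A_ al a -> \sum_(k < m) S k (a_ k al a) = T a) ->
  \sum_(k < m) lucdual_act (psi k) (S k) = T.
Proof.
move=> [pU pcof] psilim pB ST; have [Amono _ Adense] := A_exh.
apply: (dual_eq_dense Adense) => x [al0 _ Ax]; rewrite blin_sumE.
have pge : p [set al | (al0 <= al)%O].
  have [//|/pcof/(_ al0)[be /= nbe lebe]] := in_ultra_setVsetC [set al | (al0 <= al)%O] pU.
  by case: nbe.
have lims : \sum_(k < m) S k (a_ k al x) @[al --> p] -->
    (\sum_(k < m) lucdual_act (psi k) (S k) x : K^o).
  apply: (@cvg_big _ _ _ _ _ _ _ _ _ (fun k al => S k (a_ k al x))) => [|k _].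
    exact: add_continuous.
  exact: weak_star_limit_act (psilim k) (S k) x.
apply: (cvg_unique (@norm_hausdorff _ _) lims).
apply: cvg_near_cst; apply: filterS2 pB pge => al Bal leal.
by rewrite ST //; exact: Amono leal _ Ax.
Qed.

Lemma luc_act_sum (F : 'I_m -> dual A) (a : A) :
  luc_act (\sum_(k < m) F k) a = \sum_(k < m) luc_act (F k) a.
Proof.
apply: (big_morph (fun T => luc_act T a)) => [T U|].
  by rewrite -{1}[T]scale1r luc_actP scale1r.
by apply/val_inj/val_inj/funext.
Qed.
End ClusterPoints.

(** The case of a single family of multipliers and [T = 0] of the preceding limit. *)
Lemma weak_star_limit_zero (R : realType) (s : scalars)
    (A : banachAlgType (scalar_field R s)) (d : Order.disp_t) (eta : orderType d)
    (A_ : eta -> set A) (p : set_system eta) (a : eta -> blin A A)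
    (psi : dual (LUC A)) (B : set eta) (S : dual A) :
  exhausting A_ -> cofinal_ultrafilter p -> weak_star_limit p a psi -> p B ->
  (forall al x, B al -> A_ al x -> S (a al x) = 0) ->
  lucdual_act psi S = 0.
Proof.
move=> Aexh pcof psilim pB S0.
have := @weak_star_limit_sum _ _ _ _ _ 1 A_ (fun=> a) Aexh p (fun=> psi) B (fun=> S) 0.
rewrite big_ord1; apply=> // al x Bal Ax.
by rewrite big_ord1 S0.
Qed.

(** * Counting right cancellable elements and sets *)

Theorem theorem5p1 (R : realType) (s : scalars)
    (A : banachAlgType (scalar_field R s))
    (d : Order.disp_t) (eta : orderType d) (m : nat)
    (A_ : eta -> set A) (a_ : 'I_m -> eta -> blin A A) :
  (exists a : A, a != 0) ->
  has_bounded_approximate_identity A ->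
  infinite_cardinal eta ->
  (0 < m)%N ->
  [\/ Fl1_base1 A_ a_, Fl1_base2 A_ a_ | Fl1_base3 A_ a_] ->
  (forall S : set (dual (LUC A)),
     subsemigroup (@luc_arens R s A) S ->
     cluster_points a_ `<=` S ->
     (Fl1_base1 A_ a_ \/ Fl1_base2 A_ a_ ->
        ([set: set (set eta)] #<=
           [set x | right_cancellable_in (@luc_arens R s A) S [set x]])%card) /\
     (Fl1_base3 A_ a_ ->
        ([set: set (set eta)] #<=
           [set G | right_cancellable_in (@luc_arens R s A) S G])%card)) /\
  (forall (ext : dual (LUC A) -> dual (dual A)) (S : set (dual (dual A))),
     (forall Psi, cluster_points a_ Psi ->
        norm_preserving_extension Psi (ext Psi)) ->
     subsemigroup (@arens R s A) S ->
     ext @` cluster_points a_ `<=` S ->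
     (Fl1_base1 A_ a_ \/ Fl1_base2 A_ a_ ->
        ([set: set (set eta)] #<=
           [set x | right_cancellable_in (@arens R s A) S [set x]])%card) /\
     (Fl1_base3 A_ a_ ->
        ([set: set (set eta)] #<=
           [set G | right_cancellable_in (@arens R s A) S G])%card)).
Proof.
move=> [a0 a0N0] bai [eta_inf _ eta_init] m0 base.
have [Aexh amult sep] :
    [/\ exhausting A_, forall k, bounded_multipliers (a_ k) & separating A_ a_].
  have k0 : 'I_m := Ordinal m0.
  case: base => base; last 2 first.
  - have /Fl1_base2_base3 base3 := base.
    by have [? ? _ _ _] := base3; split=> //; exact: Fl1_base3_separating.
  - by have [? ? _ _ _] := base; split=> //; exact: Fl1_base3_separating.
  split; [by have [_ /(_ k0)[[]]] := base| |exact: Fl1_base1_separating].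
  by move=> k; have [_ /(_ k)[[]]] := base.
have [p [pcof pdisj]] := separated_cofinal_ultrafilters eta_inf eta_init.
have /choice[psi0 psi0P] : forall u : set (set eta) * 'I_m,
    exists Psi, weak_star_limit (p u.1) (a_ u.2) Psi.
  by move=> u; apply: weak_star_limit_exists => //; have [] := pcof u.1.
pose psi E k := psi0 (E, k).
have psiP E k : weak_star_limit (p E) (a_ k) (psi E k) by exact: psi0P (E, k).
have psiX E k : cluster_points a_ (psi E k) by exists k => //; exists (p E).
have psi_onto E T : exists S : 'I_m -> dual A,
    \sum_(k < m) lucdual_act (psi E k) (S k) = T.
  have [S [ST _]] := sep T setT; exists S.
  apply: (weak_star_limit_sum Aexh (pcof E) (psiP E) _ ST).
  by have [? _] := pcof E; exact: filterT.
(* For [B] in [p E] with complement in [p E'], the functionals [S k] combine to [T] under the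
   [psi E k] but are annihilated by every [psi E' l]. This would force [T = 0]. *)
have psi_inj E E' : (forall k, exists l, psi E k = psi E' l) -> E = E'.
  move=> EE'; apply: contrapT => /pdisj[B [pB pB']].
  have [T Ta0] := dual_nonzero a0N0.
  have [S [ST S0]] := sep T B.
  have := weak_star_limit_sum Aexh (pcof E) (psiP E) pB ST.
  rewrite big1 => [T0|k _]; first by move: Ta0; rewrite -T0 eqxx.
  have [l ->] := EE' k.
  apply: (weak_star_limit_zero Aexh (pcof E') (psiP E' l) pB') => al x nB Ax.
  exact: S0.
have m1 : Fl1_base1 A_ a_ \/ Fl1_base2 A_ a_ -> m = 1%N by move=> [[]|[]].
split=> [S _ XS|ext S extP _ XS].
  have [||c1 c2] := @right_cancellable_card _ (@luc_arens R s A) S _ _ psi _ _ psi_inj.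
  - by move=> E k; exact: XS.
  - move=> E Phi /luc_functional_nonzero[T [a PhiTa]].
    have [U UT] := psi_onto E T.
    apply: contrapT => nk; case/eqP: PhiTa.
    (* The identity [Psi . (S . a) = (Psi . S) . a] turns the decomposition of [T] into one of
       [T . a] inside LUC(A), to which the products [Phi Psi_k] apply. *)
    have -> : luc_act T a = \sum_(k < m) luc_lucdual_act (psi E k) (luc_act (U k) a).
      rewrite -UT luc_act_sum; apply: eq_bigr => k _.
      by apply/val_inj; rewrite /= lucdual_act_dual_act.
    rewrite linear_sum big1 // => k _.
    have Phi_k : luc_arens Phi (psi E k) = 0.
      by apply/eqP; apply: contrapT => /negP nz; apply: nk; exists k.
    by transitivity (luc_arens Phi (psi E k) (luc_act (U k) a)); last by rewrite Phi_k.
  by split=> [/m1/c1//|_].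
have extE E k (F : LUC A) : ext (psi E k) (luc_fun F) = psi E k F.
  by have [H _] := extP _ (psiX E k); exact: H.
have [|||c1 c2] := @right_cancellable_card _ (@arens R s A) S _ _ (fun E k => ext (psi E k)).
- by move=> E k; apply: XS; exists (psi E k).
- move=> E Phi Phi0; have [T PhiT] : exists T, Phi T != 0.
    apply: contrapT => nT; case/eqP: Phi0; apply/val_inj/funext => T.
    by apply/eqP; apply: contrapT => /negP H; apply: nT; exists T.
  have [U UT] := psi_onto E T.
  apply: contrapT => nk; case/eqP: PhiT.
  rewrite -UT linear_sum big1 // => k _.
  have Phi_k : arens Phi (ext (psi E k)) = 0.
    by apply/eqP; apply: contrapT => /negP nz; apply: nk; exists k.
  transitivity (arens Phi (ext (psi E k)) (U k)); last by rewrite Phi_k.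
  (* Every [dual_act (U k) x] lies in LUC(A), where [ext (psi E k)] agrees with [psi E k]; so both
     act on [U k] in the same way. *)
  congr (Phi _).
  by apply/val_inj/funext => x /=; rewrite -(extE E k).
(* Restricting to LUC(A) recovers [psi E k] from its extension, so coinciding extensions come from
   coinciding cluster points. *)
- move=> E E' EE'; apply: psi_inj => k; have [l kl] := EE' k; exists l.
  by apply/val_inj/funext => F; rewrite /= -!extE kl.
by split=> [/m1/c1//|_].
Qed.
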